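(* Let $C:f=0$ be a reduced curve of degree $d\geq 3$ in $\mathbb{P}^2$ and let $r_j$, $j=1,\dots,m$, be a minimal system of homogeneous generators of $AR(f)$ with $d_1\leq\dots\leq d_m$, where $d_j=\deg r_j$. Assume that $m\geq 3$ (i.e. $C$ is not free) and that $g_k=v(r_k)$, $k=2,3$, generate a complete intersection ideal $B'(C,r_1)=(g_2,g_3)$ in $S$. Then $$\tau(C)\geq (d-1)(d-d_1-1)+d_1^2-[d_1-(d-1-d_2)][d_1-(d-1-d_3)],$$ and equality holds if and only if $C$ is a 3-syzygy curve.
   Context: Let $S=\mathbb{C}[x,y,z]$ with its standard grading, $f\in S$ homogeneous of degree $d$. Put $AR(f)=\{(a,b,c)\in S^3: af_x+bf_y+cf_z=0\}$, a graded $S$-module in which $(a,b,c)$ has degree $k$ when $a,b,c\in S_k$. The curve $C$ is an $m$-syzygy curve if a minimal set of homogeneous generators of $AR(f)$ has $m$ elements. Write $r_1=(a_1,b_1,c_1)$, a nonzero syzygy of minimal degree $d_1$. For a homogeneous $r=(a,b,c)\in AR(f)$ let $\Delta(r)$ be the determinant of the $3\times 3$ matrix with rows $(x,y,z)$, $(a_1,b_1,c_1)$, $(a,b,c)$. It is known that $f$ divides $\Delta(r)$; set $v(r)=\Delta(r)/f\in S$. ''Complete intersection'' means that $g_2,g_3$ have no common factor of positive degree and generate a proper ideal (of codimension 2). The total Tjurina number $\tau(C)$ is the sum of the Tjurina numbers of the singular points of $C$. *)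

(* Defs.v *)
From HB Require Import structures.
From mathcomp Require Import all_boot all_order all_algebra.
From mathcomp Require Import boolp classical_sets fsbigop reals.
From mathcomp Require Import fraction complex mpoly.

Set Implicit Arguments.
Unset Strict Implicit.
Unset Printing Implicit Defensive.

Import GRing.Theory.
Local Open Scope ring_scope.

Section Divisibility.
Variables (K : fieldType) (n : nat).
Implicit Types g h f : {mpoly K[n]}.

Definition mdvd g f : Prop := exists h, f = h * g.

(* msize h <= 1 says that h is constant. *)
Definition squarefree f : Prop :=
  f != 0 /\ forall h, mdvd (h ^+ 2) f -> (msize h <= 1)%N.

Definition complete_intersection2 g h : Prop :=
  (forall e, mdvd e g -> mdvd e h -> (msize e <= 1)%N) /\
  ~ (exists a b : {mpoly K[n]}, 1 = a * g + b * h).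

End Divisibility.

Section Syzygies.
Variable K : fieldType.
Local Notation S := {mpoly K[3]}.
Implicit Types (f : S) (s r : 'rV[S]_3).

Definition AR f s : Prop := \sum_(i < 3) s 0 i * f^`M(i) = 0.

Definition vhomog (k : nat) s : Prop := forall i, s 0 i \is k.-homog.

Definition generatesAR f m (r : m.-tuple 'rV[S]_3) (J : {set 'I_m}) : Prop :=
  forall s, AR f s -> exists c : 'I_m -> S, s = \sum_(j in J) c j *: tnth r j.

Definition min_generators f m (r : m.-tuple 'rV[S]_3) (ds : m.-tuple nat) :=
  [/\ forall j, AR f (tnth r j),
      forall j, vhomog (tnth ds j) (tnth r j),
      generatesAR f r finset.setT &
      forall J : {set 'I_m}, J \proper finset.setT -> ~ generatesAR f r J].

Definition syzygy_curve f (m : nat) : Prop :=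
  exists (r : m.-tuple 'rV[S]_3) (ds : m.-tuple nat), min_generators f r ds.

Definition Delta r1 r : S :=
  \det (\matrix_(i < 3) [:: \row_j 'X_j; r1; r]`_i).

(* v(r) = Delta(r) / f: the quotient is unique because S is a domain; the
   default value 0 is only used when f does not divide Delta(r). *)
Definition vquot f r1 r : S := xget 0 [set g : S | Delta r1 r = g * f]%classic.

End Syzygies.

Section Tjurina.
Variable K : fieldType.
Local Notation A := {mpoly K[2]}.
Local Notation Frac := {fraction A}.
Local Notation "x %:F" := (tofrac x).

(* The local ring of the affine plane at q, inside K(u, v). *)
Definition local_ring (q : 'I_2 -> K) : set Frac :=
  [set x | exists a b : A, b.@[q] != 0 /\ x = a%:F / b%:F]%classic.

Definition tjurina_ideal (q : 'I_2 -> K) (g : A) : set Frac :=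
  [set x | exists (a : Frac) (b : 'I_2 -> Frac),
     [/\ local_ring q a, forall k, local_ring q (b k) &
         x = a * g%:F + \sum_(k < 2) b k * (g^`M(k))%:F]]%classic.

(* The K-vector space V / W has dimension n: some e_1, ..., e_n in V form a
   basis modulo W. *)
Definition has_qdim (V W : set Frac) (n : nat) : Prop :=
  exists e : 'I_n -> Frac,
    (forall i, V (e i)) /\
    (forall x, V x ->
       exists! c : 'rV[K]_n, W (x - \sum_(i < n) ((c 0 i)%:MP)%:F * e i)).

(* 0 when the quotient is infinite-dimensional, which does not happen at the
   points of a reduced curve. *)
Definition local_tjurina (q : 'I_2 -> K) (g : A) : nat :=
  xget 0%N [set n | has_qdim (local_ring q) (tjurina_ideal q g) n]%classic.

(* The restriction of f to the affine chart where the i-th coordinate is 1. *)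
Definition dehomog (i : 'I_3) (f : {mpoly K[3]}) : A :=
  f \mPo [tuple if unlift i j is Some k then 'X_k else 1 | j < 3].

Definition tjurina (f : {mpoly K[3]}) (p : 'rV[K]_3) : nat :=
  let i := odflt ord0 [pick i | p 0 i != 0] in
  local_tjurina (fun k => p 0 (lift i k) / p 0 i) (dehomog i f).

(* Each point of P^2 has exactly one representative whose first nonzero
   coordinate is 1. *)
Definition proj_plane : set 'rV[K]_3 :=
  [set p | exists i : 'I_3,
     p 0 i = 1 /\ forall j : 'I_3, (j < i)%N -> p 0 j = 0]%classic.

Definition singular_points (f : {mpoly K[3]}) : set 'rV[K]_3 :=
  [set p | [/\ proj_plane p, f.@[p 0] = 0 &
               forall i, (f^`M(i)).@[p 0] = 0]]%classic.

(* This sum over a set is 0 when its support is infinite; the singular locus of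
   a reduced curve is finite. *)
Definition total_tjurina (f : {mpoly K[3]}) : nat :=
  (\sum_(p \in singular_points f) tjurina f p)%R.

End Tjurina.

(* Main.v *)
Require Import Defs.
From HB Require Import structures.
From mathcomp Require Import all_boot all_order all_algebra.
From mathcomp Require Import boolp classical_sets fsbigop reals.
From mathcomp Require Import fraction complex mpoly.
From mathcomp Require Import ring zify.

(** Let S = K[x,y,z], J the Jacobian ideal of f, and let g range over the
  quotients Delta(r1, s) / f for s in AR(f). Since a syzygy s with
  Delta(r1, s) = 0 is a multiple of r1, counting dimensions in the sequences
  S_k^3 -> J_{k+d-1} and AR(f)_k -> S shows that, for k large, dim (S/J)_k is
  the right-hand side of the inequality plus the codimension of (g2, g3) in the
  ideal of all the g, in a fixed large degree.

  In particular the Hilbert function of S/J is bounded. Let I be a homogeneous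
  ideal with this property, and I_p the ideal of the forms that lie in I locally
  at the point p. Forms not vanishing at p act bijectively on S/I_p in large
  degrees, so dim (S/I_p)_k is eventually the length of the local ring at p
  modulo I. A form that lies in all the I_p lies in the saturation of I:
  otherwise, multiplying it by linear factors of binary forms would isolate an
  associated point of I, at which it does not lie in I_p. A linear form without
  common zero with I acts bijectively on S/I in large degrees, so I and its
  saturation agree there. Hence dim (S/I)_k is eventually the sum of the local
  lengths, which for I = J is the total Tjurina number.

  When equality holds, (g2, g3) agrees with the ideal of all the g in large
  degrees, hence everywhere because a complete intersection of two forms in
  three variables is saturated; this means that r1, r2, r3 generate AR(f). *)

Set Implicit Arguments.
Unset Strict Implicit.
Unset Printing Implicit Defensive.
Import GRing.Theory Num.Theory.
Local Open Scope ring_scope.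

(** * Factorial domains *)

(** Unique factorization in S is used three times: f divides Delta(r1, s); a syzygy proportional to
    r1 is a multiple of it; the relations between g2 and g3 are the Koszul ones. Divisibility by f
    comes from the identity Delta(r1, s) f_j = d f c_j, where c is the vector product of r1 and s:
    both rows are orthogonal to the gradient of f, so c is parallel to it.

    The constants are what remains of alternating sums of dim S_n = (n + 1)(n + 2) / 2, in which all
    terms in k cancel. The local-global theory needs a bound on the Hilbert function of S / J
    beforehand; it comes from the same count, estimating the space of the Delta(r1, s) by all
    multiples of f of that degree.

    Local lengths are read off from spaces of forms of one large degree. The passage to the local
    rings, which live in the fraction field of an affine chart, rests on Euler's identity: because
    of it the Tjurina ideal, generated by f and two partial derivatives, is the localization of the
    ideal J of all three. *)

Section EuclidProperty.
Variable R : idomainType.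
Implicit Types a b c p : R.

Definition divides a b := exists c, b = c * a.

Definition prime_elt p :=
  [/\ p != 0, p \isn't a GRing.unit &
      forall a b, divides p (a * b) -> divides p a \/ divides p b].

Definition irreducible_elt p :=
  [/\ p != 0, p \isn't a GRing.unit &
      forall a b, p = a * b -> a \is a GRing.unit \/ b \is a GRing.unit].

(** Together with a size that decreases on proper factors, this amounts to unique factorization; in
    this form it can be carried from R to R[X]. *)
Definition euclid_property := forall p, irreducible_elt p -> prime_elt p.

Definition factor_size (sz : R -> nat) :=
  forall a b, a \isn't a GRing.unit -> a * b != 0 -> (sz b < sz (a * b)%R)%N.

Lemma irreducible_divisor sz a : factor_size sz ->
  a != 0 -> a \isn't a GRing.unit ->
  exists p c, irreducible_elt p /\ a = c * p.
Proof.
move=> Hsz; have [n] := ubnP (sz a); elim: n a => // n IH a /ltnSE-le a0 aU.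
have [irr|] := pselect (irreducible_elt a).
  by exists a, 1; rewrite mul1r.
move=> nirr; have: exists b c, [/\ a = b * c, b \isn't a GRing.unit
    & c \isn't a GRing.unit].
  apply: contrapT => H; apply: nirr; split=> // b c E.
  have [bU|bU] := boolP (b \is a GRing.unit); first by left.
  by right; apply: contrapT => /negP cU; apply: H; exists b, c.
move=> [b [c [E bU cU]]].
have c0 : c != 0 by apply: contraNneq a0 => c0; rewrite E c0 mulr0.
have [] := IH c _ c0 cU.
  by apply: leq_trans le; rewrite E; apply: Hsz; rewrite -?E.
by move=> p [e [irr Ec]]; exists p, (b * e); rewrite E Ec mulrA.
Qed.

Hypothesis euclid : euclid_property.
Variable sz : R -> nat.
Hypothesis Hsz : factor_size sz.

Lemma prime_divisor a : a != 0 -> a \isn't a GRing.unit ->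
  exists p c, prime_elt p /\ a = c * p.
Proof.
move=> a0 aU; have [p [c [/euclid pp ->]]] := irreducible_divisor Hsz a0 aU.
by exists p, c.
Qed.

(** Induction on the number of prime factors; it replaces an explicit factorization into a product
    of primes. *)
Lemma prime_ind (P : R -> Prop) :
  (forall u, u \is a GRing.unit -> P u) ->
  (forall p c, prime_elt p -> c != 0 -> P c -> P (c * p)) ->
  forall a, a != 0 -> P a.
Proof.
move=> PU PM a; have [n] := ubnP (sz a); elim: n a => // n IH a /ltnSE-le a0.
have [aU|aU] := boolP (a \is a GRing.unit); first exact: PU.
have [p [c [pp E]]] := prime_divisor a0 aU; rewrite E.
have c0 : c != 0 by apply: contraNneq a0 => c0; rewrite E c0 mul0r.
apply: PM => //; apply: IH => //; apply: leq_trans le.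
by rewrite E mulrC; apply: Hsz; [case: pp | rewrite mulrC -E].
Qed.

(** The primes of g are removed one at a time: each divides p h, and by coprimality it cannot divide
    h. *)
Lemma coprime_divides g h p q : g != 0 ->
  (forall e, divides e g -> divides e h -> e \is a GRing.unit) ->
  p * h = q * g -> divides g p.
Proof.
move=> g0 cop; move: g g0 p q cop; apply: prime_ind => [u uU p q _ _|].
  by exists (p / u); rewrite divrK.
move=> e g pe g0 IH p q cop E; have [e0 eU eP] := pe.
have [|[p' Ep]|dh] := eP p h; first by exists (q * g); rewrite E mulrA.
  have [||g' Eg] := IH p' q.
  - move=> e' [x Ex] dh; apply: cop => //; by exists (x * e); rewrite Ex mulrAC.
  - by apply: (mulIf e0); rewrite mulrAC -Ep E mulrA.
  by exists g'; rewrite Ep Eg mulrA.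
by case: (negP eU); apply: cop => //; exists g.
Qed.

End EuclidProperty.

(** * Gauss's lemma and Euclid's lemma over a factorial domain *)

Section PolyEuclid.
Variable R : idomainType.
Implicit Types F G H : {poly R}.

Lemma divides_polyC (p : R) F : divides p%:P F <-> forall i, divides p F`_i.
Proof.
split=> [[G ->] i|]; first by exists G`_i; rewrite coefMC.
move=> /choice[c cP]; exists (\poly_(i < size F) c i).
apply/polyP => i; rewrite coefMC coef_poly; case: ltnP => [_|le]; first exact: cP.
by rewrite mul0r nth_default.
Qed.

Lemma polyC_unit (c : R) : (c%:P \is a GRing.unit) = (c \is a GRing.unit).
Proof.
apply/idP/idP => [|cU]; last exact: (rmorph_unit polyC).
move=> /unitrP[G [_ E]]; apply/unitrPr; exists G`_0.
by rewrite -coefCM E coef1.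
Qed.

Lemma prime_polyC (p : R) : prime_elt p -> prime_elt p%:P.
Proof.
move=> [p0 pU pP]; split; rewrite ?polyC_eq0 ?polyC_unit // => F G.
have [n] := ubnP (size F + size G); elim: n F G => // n IH F G /ltnSE-le dFG.
have [->|F0] := eqVneq F 0; first by left; exists 0; rewrite mul0r.
have [->|G0] := eqVneq G 0; first by right; exists 0; rewrite mul0r.
have peel H : H != 0 -> divides p (lead_coef H) -> exists H',
    (size H' < size H)%N /\ exists D, H = H' + D * p%:P.
  move=> H0 [c cP]; exists (H - (lead_coef H)%:P * 'X^((size H).-1)); split.
    rewrite -ltnS -(prednK (n := size H)) ?size_poly_gt0 // !ltnS.
    apply/leq_sizeP => j; rewrite leq_eqVlt => /predU1P[<-|lt].
      by rewrite coefB coefCM coefXn eqxx mulr1 subrr.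
    rewrite coefB coefCM coefXn gtn_eqF // mulr0 subr0 nth_default //.
    by rewrite -(prednK (n := size H)) ?size_poly_gt0.
  by exists (c%:P * 'X^((size H).-1)); rewrite cP polyCM mulrAC subrK.
have: divides p (lead_coef F * lead_coef G).
  by rewrite -lead_coefM; move/divides_polyC: dFG; apply.
move=> /pP[/(peel _ F0)|/(peel _ G0)] [H [lt [D E]]].
- have [| |[Q EQ]|dG] := IH H G.
  + by apply: leq_trans le; rewrite ltn_add2r.
  + by case: dFG => Q EQ; exists (Q - D * G); rewrite mulrBl -EQ E; ring.
  + by left; exists (Q + D); rewrite E EQ mulrDl.
  + by right.
- have [| |dF|[Q EQ]] := IH F H.
  + by apply: leq_trans le; rewrite ltn_add2l.
  + by case: dFG => Q EQ; exists (Q - D * F); rewrite mulrBl -EQ E; ring.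
  + by left.
  + by right; exists (Q + D); rewrite E EQ mulrDl.
Qed.

Hypothesis euclid : euclid_property R.
Variable sz : R -> nat.
Hypothesis Hsz : factor_size sz.

Definition primitive_poly F := forall p, prime_elt p -> ~ divides p%:P F.

(** Constants introduced by pseudo-division are removed here: each prime of c stays prime in R[X],
    does not divide F, and so divides Q. *)
Lemma primitive_cancel F : primitive_poly F ->
  forall c : R, c != 0 -> forall Q H, c%:P * H = Q * F -> divides F H.
Proof.
move=> prF; apply: (prime_ind euclid Hsz) => [u uU Q H E|p c pp c0 IH Q H E].
  by exists (u^-1%:P * Q); rewrite -mulrA -E mulrA -polyCM mulVr // mul1r.
have [p0 _ _] := pp; have [_ _ pP] := prime_polyC pp.
have [|[Q' EQ]|] := pP Q F; first by exists (c%:P * H); rewrite -E polyCM; ring.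
  apply: (IH Q'); have p0' : p%:P != 0 by rewrite polyC_eq0.
  by apply: (mulIf p0'); rewrite mulrAC -polyCM E EQ; ring.
by move=> /(prF _ pp).
Qed.

(** Each prime of c divides D or U and is cancelled there, which leaves the degrees unchanged: a
    factorization over the fraction field descends to R. *)
Lemma primitive_split F : primitive_poly F ->
  forall c : R, c != 0 -> forall D U, c%:P * F = D * U ->
  exists D' U', [/\ F = D' * U', size D' = size D & size U' = size U].
Proof.
move=> prF; apply: (prime_ind euclid Hsz) => [u uU D U E|p c pp c0 IH D U E].
  exists (u^-1%:P * D), U; split => //.
    by rewrite -mulrA -E mulrA -polyCM mulVr // mul1r.
  by rewrite mul_polyC size_scale // invr_eq0; apply: contraTneq uU => ->; rewrite unitr0.
have [p0 _ _] := pp; have [_ _ pP] := prime_polyC pp.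
have p0' : p%:P != 0 by rewrite polyC_eq0.
have szp (H : {poly R}) : size (H * p%:P) = size H by rewrite mulrC mul_polyC size_scale.
have [|[D' ED]|[U' EU]] := pP D U; first by exists (c%:P * F); rewrite -E polyCM; ring.
  have [|D1 [U1 [EF sD sU]]] := IH D' U.
    by apply: (mulIf p0'); rewrite mulrAC -polyCM E ED; ring.
  by exists D1, U1; split => //; rewrite ED szp.
have [|D1 [U1 [EF sD sU]]] := IH D U'.
  by apply: (mulIf p0'); rewrite mulrAC -polyCM E EU; ring.
by exists D1, U1; split => //; rewrite EU szp.
Qed.

(** A constant F is a prime of R. A nonconstant F is primitive; if it is not coprime to G,
    irreducibility makes the cofactor U of the gcd D a constant, so F divides D up to constants, and
    primitivity removes these constants. *)
Lemma poly_euclid : euclid_property {poly R}.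
Proof.
move=> F [F0 FU Firr].
have [sF|sF] := leqP (size F) 1.
  have EF : F = (F`_0)%:P by apply: size1_polyC.
  rewrite EF; apply: prime_polyC; apply: euclid; split.
  - by rewrite -polyC_eq0 -EF.
  - by rewrite -polyC_unit -EF.
  - by move=> a b E; rewrite -2!polyC_unit; apply: Firr; rewrite -polyCM -E.
have prF : primitive_poly F.
  move=> p [p0 pU _] [G E]; have [GU|] := Firr _ _ E; last by rewrite polyC_unit (negPf pU).
  move: sF; rewrite E mulrC mul_polyC size_scale //.
  by move: GU; rewrite poly_unitE => /andP[/eqP->].
split=> // G H [Q EQ].
have pdvd A : Pdiv.Idomain.dvdp F A -> divides F A.
  move=> /Pdiv.WeakIdomain.dvdpP[[c q] /= c0 E].
  by apply: (primitive_cancel prF c0 (Q := q)); rewrite mul_polyC.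
have dGH : Pdiv.Idomain.dvdp F (G * H) by rewrite EQ; apply: dvdp_mull.
have [cop|ncop] := boolP (coprimep F G).
  by right; apply: pdvd; rewrite Gauss_dvdpr in dGH.
left; apply: pdvd; set D := gcdp F G.
have /Pdiv.WeakIdomain.dvdpP[[c U] /= c0 E] : Pdiv.Idomain.dvdp D F by apply: dvdp_gcdl.
rewrite -mul_polyC in E.
have [U' [D' [EF sU sD]]] := primitive_split prF c0 E.
have szU : size U = 1%N.
  have [|] := Firr _ _ EF; rewrite poly_unitE => /andP[/eqP sz1 _].
    by rewrite -sU.
  by move: ncop; rewrite coprimep_def -/D -sD sz1 eqxx.
have DF : Pdiv.Idomain.dvdp F D.
  have U0 : U`_0 != 0 by rewrite -polyC_eq0 -size1_polyC ?szU // -size_poly_eq0 szU.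
  rewrite -(dvdpZr _ _ U0) -mul_polyC -size1_polyC ?szU // -E mul_polyC.
  by rewrite dvdpZr // dvdpp.
by apply: dvdp_trans DF _; apply: dvdp_gcdr.
Qed.

End PolyEuclid.

(** * Factoriality of multivariate polynomial rings *)

Section MpolyEuclid.

Lemma mpoly_rmorph_ext (A S : comNzRingType) n
    (f g : {rmorphism {mpoly A[n]} -> S}) :
  (forall c, f c%:MP = g c%:MP) -> (forall i, f 'X_i = g 'X_i) -> f =1 g.
Proof.
move=> EC EX p; rewrite [p]mpolyE !rmorph_sum; apply: eq_bigr => m _.
rewrite -!mul_mpolyC !rmorphM EC; congr (_ * _).
rewrite mpolyXE_id !rmorph_prod; apply: eq_bigr => i _.
by rewrite !rmorphXn EX.
Qed.

Lemma euclid_property_iso (A B : idomainType) (phi : {rmorphism A -> B})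
    (psi : {rmorphism B -> A}) :
  cancel phi psi -> cancel psi phi -> euclid_property B -> euclid_property A.
Proof.
move=> phiK psiK eB p [p0 pU pirr].
have phiU a : (phi a \is a GRing.unit) = (a \is a GRing.unit).
  by apply/idP/idP => [/(rmorph_unit psi)|/(rmorph_unit phi)//]; rewrite phiK.
have psiU a : (psi a \is a GRing.unit) = (a \is a GRing.unit) by rewrite -phiU psiK.
have [|_ _ pP] := eB (phi p).
  split; rewrite ?phiU //; first by apply: contraNneq p0 => /(congr1 psi); rewrite phiK rmorph0 => ->.
  move=> a b E; rewrite -!psiU; apply: pirr.
  by rewrite -rmorphM -E phiK.
split=> // a b [c E].
have [|[d Ed]|[d Ed]] := pP (phi a) (phi b).
  by exists (phi c); rewrite -!rmorphM E.
- by left; exists (psi d); rewrite -[a]phiK Ed rmorphM phiK.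
- by right; exists (psi d); rewrite -[b]phiK Ed rmorphM phiK.
Qed.

Variable K : fieldType.

(** The first variable becomes the polynomial variable over the ring in the remaining ones;
    [mpoly_merge] is the inverse isomorphism. *)
Definition mpoly_split n : {mpoly K[n.+1]} -> {poly {mpoly K[n]}} :=
  mmap (polyC \o @mpolyC n K)
    (fun i => if unlift ord0 i is Some j then ('X_j)%:P else 'X).

HB.instance Definition _ n := GRing.RMorphism.on (@mpoly_split n).

Definition mpoly_lift n : {mpoly K[n]} -> {mpoly K[n.+1]} :=
  mmap (@mpolyC n.+1 K) (fun j => 'X_(lift ord0 j)).

HB.instance Definition _ n := GRing.RMorphism.on (@mpoly_lift n).

Definition mpoly_merge n (p : {poly {mpoly K[n]}}) : {mpoly K[n.+1]} :=
  (map_poly (@mpoly_lift n) p).['X_ord0].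

Lemma mpoly_merge_is_additive n : additive (@mpoly_merge n).
Proof. by move=> p q; rewrite /mpoly_merge rmorphB hornerD hornerN. Qed.

Lemma mpoly_merge_is_multiplicative n : multiplicative (@mpoly_merge n).
Proof.
split=> [p q|]; first by rewrite /mpoly_merge rmorphM hornerM.
by rewrite /mpoly_merge rmorph1 hornerC.
Qed.

HB.instance Definition _ n := GRing.isAdditive.Build _ _ (@mpoly_merge n)
  (@mpoly_merge_is_additive n).
HB.instance Definition _ n := GRing.isMultiplicative.Build _ _ (@mpoly_merge n)
  (@mpoly_merge_is_multiplicative n).

Lemma mpoly_splitK n : cancel (@mpoly_split n) (@mpoly_merge n).
Proof.
apply: (@mpoly_rmorph_ext _ _ _ (@mpoly_merge n \o @mpoly_split n) idfun) => [c|i] /=.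
  rewrite [mpoly_split _]mmapC /= /mpoly_merge map_polyC hornerC.
  exact: mmapC.
rewrite [mpoly_split _]mmapX mmap1U /mpoly_merge; case: unliftP => [j ->|->].
  by rewrite map_polyC hornerC /= [mpoly_lift _]mmapX mmap1U.
by rewrite map_polyX hornerX.
Qed.

Lemma mpoly_mergeK n : cancel (@mpoly_merge n) (@mpoly_split n).
Proof.
have E a : mpoly_split (mpoly_lift a) = a%:P :> {poly {mpoly K[n]}}.
  move: a; apply: (@mpoly_rmorph_ext _ _ _ (@mpoly_split n \o @mpoly_lift n) polyC) => [c|i] /=.
    by rewrite [mpoly_lift _]mmapC [mpoly_split _]mmapC.
  by rewrite [mpoly_lift _]mmapX mmap1U [mpoly_split _]mmapX mmap1U liftK.
elim/poly_ind => [|p c IH]; first by rewrite !rmorph0.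
rewrite !rmorphD !rmorphM /= IH; congr (_ * _ + _).
  by rewrite /mpoly_merge map_polyX hornerX [mpoly_split _]mmapX mmap1U unlift_none.
by rewrite /mpoly_merge map_polyC hornerC E.
Qed.

Lemma msize_mul n (p q : {mpoly K[n]}) : p != 0 -> q != 0 ->
  msize (p * q) = (msize p + msize q).-1.
Proof. exact: msizeM. Qed.

Lemma mpoly_unitE n (p : {mpoly K[n]}) : (p \is a GRing.unit) = (msize p == 1%N).
Proof.
apply/idP/idP => [/unitrP[q [_ E]]|/msize_poly1P[c c0 ->]]; last first.
  by apply: (rmorph_unit (@mpolyC n K)); rewrite unitfE.
have [p0|p0] := eqVneq p 0; first by move/eqP: E; rewrite p0 mul0r eq_sym oner_eq0.
have [q0|q0] := eqVneq q 0; first by move/eqP: E; rewrite q0 mulr0 eq_sym oner_eq0.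
have := msize_mul p0 q0; rewrite E msize1.
by move: p0 q0; rewrite -!msize_poly_eq0; case: (msize p) => [|[|a]] //; case: (msize q) => // b _ _; rewrite !addSn addnS.
Qed.

Lemma msize_factor n : factor_size (fun p : {mpoly K[n]} => msize p).
Proof.
move=> a b; rewrite mpoly_unitE => aU; rewrite mulf_eq0 negb_or => /andP[a0 b0].
rewrite msize_mul //; move: a0 b0 aU; rewrite -!msize_poly_eq0.
by case: (msize a) => [|[|k]] //; case: (msize b) => // l _ _ _; rewrite !addSn /= ltnS leq_addl.
Qed.

Lemma mpoly_euclid n : euclid_property {mpoly K[n]}.
Proof.
elim: n => [|n IH]; last first.
  apply: (euclid_property_iso (@mpoly_splitK n) (@mpoly_mergeK n)).
  exact: (poly_euclid IH (@msize_factor n)).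
(* Without variables a nonzero polynomial is constant, hence a unit, so there are no irreducible
   elements. *)
move=> p [p0 + _]; rewrite mpoly_unitE.
have /dhomogP h : p \is [in K[0], 0.-homog] by apply: nvar0_homog.
suff -> : msize p = 1%N by [].
have : (msize p <= 1)%N.
  by rewrite msizeE; apply/bigmax_leqP_seq => m /h /= ->.
by move: p0; rewrite -msize_poly_eq0; case: (msize p) => [|[]].
Qed.

Lemma mpoly_coprime_mdvd n (g h p q : {mpoly K[n]}) : g != 0 ->
  (forall e, mdvd e g -> mdvd e h -> (msize e <= 1)%N) ->
  p * h = q * g -> mdvd g p.
Proof.
move=> g0 cop; apply: (coprime_divides (@mpoly_euclid n) (@msize_factor n)) => //.
move=> e eg eh; rewrite mpoly_unitE eqn_leq cop //= lt0n msize_poly_eq0.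
by apply: contraNneq g0 => e0; case: eg => x ->; rewrite e0 mulr0.
Qed.

End MpolyEuclid.

Lemma mderiv_eq0_msize (K : numFieldType) n (p : {mpoly K[n]}) :
  (forall i, p^`M(i) = 0) -> (msize p <= 1)%N.
Proof.
move=> H; rewrite msizeE; apply/bigmax_leqP_seq => m mp _.
rewrite ltnS leqn0 mdeg_eq0; apply/eqP/mnmP => i; rewrite mnm0E.
apply/eqP/negPn/negP => mi.
have := congr1 (fun q => q@_(m - U_(i))) (H i); rewrite mcoeff_deriv mcoeff0.
rewrite submK; last by rewrite lep1mP.
move/eqP; rewrite -mulr_natr mulf_eq0 pnatr_eq0 //= orbF.
by rewrite mcoeff_eq0 mp.
Qed.

Lemma msize_mderiv (K : numFieldType) n (p : {mpoly K[n]}) i :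
  p^`M(i) != 0 -> (msize p^`M(i) < msize p)%N.
Proof.
move=> d0; have p0 : p != 0 by apply: contraNneq d0 => ->; rewrite mderiv0.
rewrite (mpolySpred _ p0) ltnS msizeE; apply/bigmax_leqP_seq => m.
rewrite mcoeff_msupp mcoeff_deriv => h _.
have : (m + U_(i))%MM \in msupp p.
  by rewrite mcoeff_msupp; apply: contraNneq h => ->; rewrite mul0rn.
move=> /msize_mdeg_lt; rewrite mdegD mdeg1 addn1 (mpolySpred _ p0) ltnS.
by [].
Qed.

(* An irreducible factor p of f cannot divide all the partial derivatives of f:
   writing f = q p with q not divisible by p, it would divide the derivatives
   of p, which have smaller degree. *)
Lemma squarefree_dvd (K : numFieldType) n (f D : {mpoly K[n]}) : squarefree f ->
  (forall i, mdvd f (D * f^`M(i))) -> mdvd f D.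
Proof.
move=> [f0 sqf] H.
suff main : forall g h, f = h * g ->
    forall D, (forall i, mdvd g (D * f^`M(i))) -> mdvd g D.
  by apply: (main f 1) => //; rewrite mul1r.
have Ksz := @msize_factor K n; have Kel := @mpoly_euclid K n.
move=> g h Ef; have g0 : g != 0 by apply: contraNneq f0 => g0; rewrite Ef g0 mulr0.
move: g g0 h Ef {H D}; apply: (prime_ind Kel Ksz) => [u uU h Ef D _|].
  by exists (D / u); rewrite divrK.
move=> p g pp g0 IH h Ef D H.
have [p0 pU pP] := pp.
have pdvd2 : ~ divides p (h * g).
  move=> [x Ex]; move: pU.
  rewrite mpoly_unitE eqn_leq lt0n msize_poly_eq0 p0 andbT => /negP; apply.
  by apply: sqf; exists x; rewrite Ef mulrA Ex expr2 mulrA.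
have [i pi] : exists i, ~ divides p f^`M(i).
  apply: contrapT => /forallNP all; apply: pdvd2.
  case: (boolP [forall i, p^`M(i) == 0]) => [/forallP z|/forallPn[i pi]].
    by move: pU; rewrite mpoly_unitE eqn_leq mderiv_eq0_msize ?lt0n ?msize_poly_eq0 ?p0 // => j; apply/eqP.
  have /contrapT[c Ec] := all i.
  have : divides p (h * g * p^`M(i)).
    exists (c - (h * g)^`M(i)); rewrite mulrBl -Ec Ef mulrA mderivM; ring.
  move=> /pP[//|[e Ee]].
  have e0 : e != 0 by apply: contraNneq pi => e0; rewrite Ee e0 mul0r.
  have := msize_mderiv pi; rewrite {1}Ee msize_mul // ltnNge => /negP[].
  move: e0; rewrite -msize_poly_eq0; case: (msize e) => // k _.
  by rewrite addSn /= leq_addl.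
have [|[D1 ED]|//] := pP D f^`M(i).
  by have [c Ec] := H i; exists (c * g); rewrite Ec mulrA.
have [||D2 E2] := IH (h * p) _ D1.
- by rewrite Ef; ring.
- move=> j; have [c Ec] := H j; exists c; apply: (mulIf p0).
  by rewrite mulrAC -ED Ec; ring.
by exists D2; rewrite ED E2; ring.
Qed.

(** * Homogeneous ideals with bounded Hilbert function *)

Lemma ord3P (P : 'I_3 -> Prop) : P (@Ordinal 3 0 isT) -> P (@Ordinal 3 1 isT) ->
  P (@Ordinal 3 2 isT) -> forall j, P j.
Proof.
move=> P0 P1 P2 [[|[|[|//]]] lt].
- by have -> : Ordinal lt = @Ordinal 3 0 isT by apply: val_inj.
- by have -> : Ordinal lt = @Ordinal 3 1 isT by apply: val_inj.
- by have -> : Ordinal lt = @Ordinal 3 2 isT by apply: val_inj.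
Qed.

Section Ideals.
Variable K : numClosedFieldType.
Local Notation S := {mpoly K[3]}.
Implicit Types (I : S -> Prop) (a b h w x y : S).

Definition ideal I :=
  [/\ I 0, forall a b, I a -> I b -> I (a + b) & forall a b, I b -> I (a * b)].

Lemma idealZ I (c : K) a : ideal I -> I a -> I (c *: a).
Proof. by move=> [_ _ IM] Ia; rewrite -mul_mpolyC; apply: IM. Qed.

Lemma idealB I a b : ideal I -> I a -> I b -> I (a - b).
Proof.
move=> HI Ia Ib; have [_ ID _] := HI; apply: ID => //.
by rewrite -scaleN1r; apply: idealZ.
Qed.

Lemma ideal_sum I (T : Type) (r : seq T) (P : pred T) (F : T -> S) : ideal I ->
  (forall i, P i -> I (F i)) -> I (\sum_(i <- r | P i) F i).
Proof. by move=> [I0 ID _] H; elim/big_ind: _. Qed.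

(* The graded pieces of S / I have dimension at most c. *)
Definition bounded_by I c := forall k (e : 'I_c.+1 -> S),
  (forall i, e i \is k.-homog) ->
  exists t : 'I_c.+1 -> K, (exists i, t i != 0) /\ I (\sum_i t i *: e i).

Definition saturation I a :=
  exists N, forall n h, (N <= n)%N -> h \is n.-homog -> I (h * a).

Lemma saturation_mul I a k h : ideal I -> h \is k.-homog ->
  saturation I a -> saturation I (h * a).
Proof.
move=> HI hh [N HN]; exists N => n g le hg; rewrite mulrA; apply: (HN (n + k)%N).
  exact: leq_trans le (leq_addr _ _).
exact: dhomogM.
Qed.

Lemma saturation_of I a : ideal I -> I a -> saturation I a.
Proof. by move=> [_ _ IM] Ia; exists 0%N => n h _ _; apply: IM. Qed.

Lemma saturationZ I (c : K) a : ideal I -> c != 0 ->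
  saturation I (c *: a) -> saturation I a.
Proof.
move=> HI c0 [N HN]; exists N => n h le hh.
have := idealZ c^-1 HI (HN n h le hh).
by rewrite -scalerAr scalerA mulVf // scale1r.
Qed.

(** The homogenization of P in degree c. A linear factor is either x - r y for a root r of P, or y
    when the coefficient of degree c vanishes, which is a root at infinity. *)
Definition binary_form c x y (P : {poly K}) :=
  \sum_(i < c.+1) P`_i *: (x ^+ i * y ^+ (c - i)).

Lemma binary_form_root c x y r (P : {poly K}) : (size P <= c.+1)%N ->
  binary_form c.+1 x y (('X - r%:P) * P) = (x - r *: y) * binary_form c x y P.
Proof.
move=> sP; rewrite /binary_form [RHS]mulrBl.
under eq_bigr => i _.
  rewrite mulrBl coefB (mulrC 'X) coefMX coefCM scalerBl; over.
rewrite sumrB; congr (_ - _).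
  rewrite big_ord_recl /= scale0r add0r mulr_sumr; apply: eq_bigr => i _.
  by rewrite -scalerAr mulrA -exprS.
rewrite big_ord_recr /= (nth_default _ sP) mulr0 scale0r addr0.
rewrite mulr_sumr; apply: eq_bigr => i _.
rewrite -scalerAl -scalerAr scalerA; congr (_ *: _).
by rewrite mulrCA -exprS subSn // -ltnS.
Qed.

Lemma binary_form_lead c x y (P : {poly K}) : (size P <= c.+1)%N ->
  binary_form c.+1 x y P = y * binary_form c x y P.
Proof.
move=> sP; rewrite /binary_form big_ord_recr /= (nth_default _ sP) scale0r addr0.
rewrite mulr_sumr; apply: eq_bigr => i _.
by rewrite -scalerAr mulrCA -exprS subSn // -ltnS.
Qed.

Lemma binary_form_homog c x y P : x \is 1.-homog -> y \is 1.-homog ->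
  binary_form c x y P \is c.-homog.
Proof.
move=> hx hy; rewrite rpred_sum // => i _; apply: rpredZ.
have := dhomogM (dhomogMn i hx) (dhomogMn (c - i) hy).
by rewrite !mul1n subnKC // -ltnS.
Qed.

(** The form splits into linear factors, which are applied to a one after the other; the last
    multiple outside the saturation is sent into it by the next factor. *)
Lemma binary_form_killer I x y c (P : {poly K}) a :
  ideal I -> x \is 1.-homog -> y \is 1.-homog ->
  P != 0 -> (size P <= c.+1)%N -> ~ saturation I a ->
  saturation I (binary_form c x y P * a) ->
  exists k h, [/\ h \is k.-homog, ~ saturation I (h * a) &
    saturation I (y * (h * a)) \/ exists r : K, saturation I ((x - r *: y) * (h * a))].
Proof.
move=> HI hx hy; elim: c P => [|c IH] P P0 sP na.
  rewrite /binary_form big_ord1 !expr0 mulr1 -scalerAl mul1r => /saturationZ.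
  have /size_poly1P[e e0 ->] : size P == 1%N.
    by rewrite eqn_leq sP size_poly_gt0.
  by rewrite coefC /= => /(_ HI e0).
have [sP'|sP'] := leqP (size P) c.+1.
  rewrite binary_form_lead // -mulrA => Hs.
  have [sw|nsw] := pselect (saturation I (binary_form c x y P * a)).
    exact: (IH P).
  exists c, (binary_form c x y P); split => //; last by left.
  exact: binary_form_homog.
have /closed_rootP[r] : size P != 1%N by rewrite gtn_eqF // (leq_trans _ sP').
move=> /factor_theorem[Q EQ].
have Q0 : Q != 0 by apply: contraNneq P0 => Q0; rewrite EQ Q0 mul0r.
have sQ : (size Q <= c.+1)%N.
  by move: sP; rewrite EQ size_Mmonic ?monicXsubC // size_XsubC addn2 /= ltnS.
rewrite EQ (mulrC Q) binary_form_root // -mulrA => Hs.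
have [sw|nsw] := pselect (saturation I (binary_form c x y Q * a)).
  exact: (IH Q).
exists c, (binary_form c x y Q); split => //; last by right; exists r.
exact: binary_form_homog.
Qed.

(** The c + 1 products x^i y^(c-i) a have the same degree, so they are dependent modulo I: a nonzero
    binary form of degree c in x and y sends a into I. *)
Lemma bounded_killer I c x y k a :
  ideal I -> bounded_by I c -> x \is 1.-homog -> y \is 1.-homog ->
  a \is k.-homog -> ~ saturation I a ->
  exists k h, [/\ h \is k.-homog, ~ saturation I (h * a) &
    saturation I (y * (h * a)) \/ exists r : K, saturation I ((x - r *: y) * (h * a))].
Proof.
move=> HI Hb hx hy ha na.
have [|t [[i ti] It]] := Hb (c + k)%N (fun i : 'I_c.+1 => (x ^+ i * y ^+ (c - i)) * a).
  move=> i; apply: dhomogM => //.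
  have := dhomogM (dhomogMn i hx) (dhomogMn (c - i) hy).
  by rewrite !mul1n subnKC // -ltnS.
pose P := \poly_(i < c.+1) t (inord i).
apply: (@binary_form_killer I x y c P) => //; last 1 first.
- apply: saturation_of => //; move: It; rewrite /binary_form mulr_suml.
  congr (I _); apply: eq_bigr => j _.
  by rewrite coef_poly ltn_ord inord_val -scalerAl.
- apply: contraNneq ti => P0; have := coef_poly c.+1 (fun i => t (inord i)) i.
  by rewrite -/P P0 coef0 ltn_ord inord_val => <-.
- exact: size_poly.
Qed.

Lemma dhomog_U i : 'X_i \is [in K[3], 1.-homog].
Proof. by rewrite dhomogX /= mdeg1. Qed.

Lemma monomial_split n (m : 'X_{1..n}) : m != 0%MM ->
  exists i m', m = (U_(i) + m')%MM.
Proof.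
rewrite -mdeg_eq0 mdegE sum_nat_eq0 => /forallPn[i /= mi].
exists i, (m - U_(i))%MM; rewrite addmC submK //.
by rewrite lep1mP.
Qed.

(** In front of w, and in large degree, each X_j may be replaced by p_j X_i modulo I, so a monomial
    of degree n acts as its value at p times X_i^n. *)
Lemma homog_mod_point I w N (p : 'I_3 -> K) i : ideal I ->
  (forall j n g, (N <= n)%N -> g \is n.-homog -> I (g * (('X_j - p j *: 'X_i) * w))) ->
  forall n h, (N < n)%N -> h \is n.-homog -> I ((h - h.@[p] *: 'X_i ^+ n) * w).
Proof.
move=> HI Hw.
(* The multiplier g takes up the variables already replaced, which keeps the total degree k + n
   above the threshold N. *)
have mono n : forall m k g, mdeg m = n -> (N < k + n)%N -> g \is k.-homog ->
    I (g * (('X_[m] - ('X_[m]).@[p] *: 'X_i ^+ n) * w)).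
  elim: n => [|n IH] m k g.
    move=> /eqP; rewrite mdeg_eq0 => /eqP -> _ _.
    by rewrite mpolyX0 meval1 expr0 scale1r subrr mul0r mulr0; case: HI.
  move=> dm lt hg; have m0 : m != 0%MM by rewrite -mdeg_eq0 dm.
  have [j [m' Em]] := monomial_split m0.
  have dm' : mdeg m' = n by move: dm; rewrite Em mdegD mdeg1 => -[].
  have [_ ID _] := HI.
  have -> : g * (('X_[m] - ('X_[m]).@[p] *: 'X_i ^+ n.+1) * w) =
     (g * 'X_[m']) * (('X_j - p j *: 'X_i) * w) +
     p j *: ((g * 'X_i) * (('X_[m'] - ('X_[m']).@[p] *: 'X_i ^+ n) * w)).
    rewrite Em mpolyXD mevalM mevalXU exprS -!mul_mpolyC rmorphM /=; ring.
  apply: ID.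
    apply: Hw (k + n)%N _ _ _; first by move: lt; rewrite addnS ltnS.
    by apply: dhomogM => //; rewrite dhomogX /= dm'.
  apply: idealZ => //; apply: (IH _ (k + 1)%N) => //; first by rewrite addn1 addSn -addnS.
  by apply: dhomogM => //; apply: dhomog_U.
move=> n h lt hh.
have -> : (h - h.@[p] *: 'X_i ^+ n) * w =
  \sum_(m <- msupp h) h@_m *: (1 * (('X_[m] - ('X_[m]).@[p] *: 'X_i ^+ n) * w)).
  rewrite {1 2}[h]mpolyE raddf_sum /= scaler_suml -sumrB mulr_suml.
  apply: eq_bigr => m _; rewrite mevalZ -!mul_mpolyC rmorphM /=; ring.
rewrite big_seq; apply: ideal_sum => // m mh; apply: idealZ => //.
apply: (mono n m 0%N) => //; last exact: dhomog1.
exact: (dhomog_mf hh).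
Qed.

(** A form b of large degree e acts on w as b(p) X_i^e modulo I. Some b with b(p) nonzero sends w
    into I: by the hypothesis on a if p is a zero of I, and otherwise because b can be taken in I.
    Hence a power of X_i sends w into I, and so do all forms of large degree. *)
Lemma killed_at_point I (p : 'rV[K]_3) i k a : ideal I ->
  p 0 i = 1 -> proj_plane p -> a \is k.-homog ->
  (forall p, @proj_plane K p -> (forall e b, b \is e.-homog -> I b -> b.@[p 0] = 0) ->
     exists e b, [/\ b \is e.-homog, b.@[p 0] != 0 & I (b * a)]) ->
  forall w h, w = h * a -> (forall j, saturation I (('X_j - p 0 j *: 'X_i) * w)) ->
  saturation I w.
Proof.
move=> HI pi pp ha Hp w h Ew Hw.
have [N HN] : exists N, forall j n g, (N <= n)%N -> g \is n.-homog ->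
    I (g * (('X_j - p 0 j *: 'X_i) * w)).
  have /choice[N HN] := Hw; exists (\max_j N j) => j n g le; apply: HN.
  exact: leq_trans (leq_bigmax j) le.
have H := homog_mod_point HI HN.
have [e [b [hb bp Ibw]]] : exists e b, [/\ b \is e.-homog, b.@[p 0] != 0 & I (b * w)].
  have [|] := pselect (forall e b, b \is e.-homog -> I b -> b.@[p 0] = 0).
    move=> /(Hp _ pp)[e [b [hb bp Iba]]]; exists e, b; split => //.
    by rewrite Ew mulrCA; case: HI => _ _; apply.
  move=> /existsNP[e /existsNP[b /not_implyP[hb /not_implyP[Ib bp]]]].
  exists e, b; split => //; first exact/eqP.
  by rewrite mulrC; case: HI => _ _; apply.
pose n0 := (e + N.+1)%N.
have Xn0 : I ('X_i ^+ n0 * w).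
  have hb' : b * 'X_i ^+ N.+1 \is n0.-homog.
    by apply: dhomogM => //; have := dhomogMn N.+1 (dhomog_U i); rewrite mul1n.
  have := H n0 _ _ hb'; rewrite ltn_addl // => /(_ isT).
  rewrite mevalM rmorphXn /= mevalXU pi expr1n mulr1 => I1.
  have := idealB HI _ I1 => /(_ (b * 'X_i ^+ N.+1 * w)).
  have -> : b * 'X_i ^+ N.+1 * w - (b * 'X_i ^+ N.+1 - b.@[p 0] *: 'X_i ^+ n0) * w
     = b.@[p 0] *: ('X_i ^+ n0 * w) by rewrite -!mul_mpolyC; ring.
  move=> I2; rewrite -[X in I X](scale1r) -(mulVf bp) -scalerA.
  apply: idealZ => //; apply: I2.
  by rewrite mulrAC mulrC; case: HI => _ _; apply.
exists n0 => n g le hg.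
have -> : g * w = (g - g.@[p 0] *: 'X_i ^+ n) * w + g.@[p 0] *: ('X_i ^+ (n - n0) * ('X_i ^+ n0 * w)).
  by rewrite mulrA -exprD subnK // -!mul_mpolyC; ring.
have [_ ID IM] := HI; apply: ID; first by apply: H => //; apply: leq_trans le; rewrite ltn_addl.
by apply: idealZ => //; apply: IM.
Qed.

(** Two rounds of [bounded_killer] turn an a outside the saturation into a multiple, still outside,
    that two independent linear forms send into it. These meet in one point, where [killed_at_point]
    gives a contradiction. The four cases are the points (0, 0, 1), (1, 0, r), (0, 1, r) and (1, r',
    r r'), already normalized. *)
Lemma projective_nullstellensatz I c k a : ideal I -> bounded_by I c ->
  a \is k.-homog ->
  (forall p, @proj_plane K p -> (forall e b, b \is e.-homog -> I b -> b.@[p 0] = 0) ->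
     exists e b, [/\ b \is e.-homog, b.@[p 0] != 0 & I (b * a)]) ->
  saturation I a.
Proof.
move=> HI Hb ha Hp; apply: contrapT => na.
pose i0 : 'I_3 := @Ordinal 3 0 isT; pose i1 : 'I_3 := @Ordinal 3 1 isT.
pose i2 : 'I_3 := @Ordinal 3 2 isT.
have plane (u : 'rV[K]_3) i : u 0 i = 1 -> (forall j : 'I_3, (j < i)%N -> u 0 j = 0) ->
  proj_plane u by exists i.
pose pt (u v t : K) : 'rV[K]_3 := \row_(j < 3) [:: u; v; t]`_j.
have sat0 w : saturation I (0 * w) by exists 0%N => n g _ _; rewrite mul0r mulr0; case: HI.
have [k1 [h1 [hh1 nw1 l1]]] := bounded_killer HI Hb (dhomog_U i2) (dhomog_U i1) ha na.
have hw1 := dhomogM hh1 ha.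
case: l1 => [l1|[r l1]].
- have [k2 [h2 [hh2 nw2 l2]]] := bounded_killer HI Hb (dhomog_U i2) (dhomog_U i0) hw1 nw1.
  have l1' : saturation I ('X_i1 * (h2 * (h1 * a))).
    by rewrite mulrCA; apply: saturation_mul hh2 l1.
  case: l2 => [l2|[r l2]]; case: nw2.
  + apply: (@killed_at_point I (pt 0 0 1) i2 k a HI _ _ ha Hp _ (h2 * h1)).
    * by rewrite mxE.
    * by apply: (plane _ i2); [rewrite mxE|apply: ord3P => // _; rewrite mxE].
    * by rewrite mulrA.
    * by apply: ord3P; rewrite mxE /= ?scale0r ?subr0 // scale1r subrr.
  + apply: (@killed_at_point I (pt 1 0 r) i0 k a HI _ _ ha Hp _ (h2 * h1)).
    * by rewrite mxE.
    * by apply: (plane _ i0); [rewrite mxE|apply: ord3P].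
    * by rewrite mulrA.
    * by apply: ord3P; rewrite mxE /= ?scale0r ?subr0 // scale1r subrr.
- have [k2 [h2 [hh2 nw2 l2]]] := bounded_killer HI Hb (dhomog_U i1) (dhomog_U i0) hw1 nw1.
  have l1' : saturation I (('X_i2 - r *: 'X_i1) * (h2 * (h1 * a))).
    by rewrite mulrCA; apply: saturation_mul hh2 l1.
  case: l2 => [l2|[r' l2]]; case: nw2.
  + apply: (@killed_at_point I (pt 0 1 r) i1 k a HI _ _ ha Hp _ (h2 * h1)).
    * by rewrite mxE.
    * by apply: (plane _ i1); [rewrite mxE|apply: ord3P => // _; rewrite mxE].
    * by rewrite mulrA.
    * by apply: ord3P; rewrite mxE /= ?scale0r ?subr0 // scale1r subrr.
  + apply: (@killed_at_point I (pt 1 r' (r * r')) i0 k a HI _ _ ha Hp _ (h2 * h1)).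
    * by rewrite mxE.
    * by apply: (plane _ i0); [rewrite mxE|apply: ord3P].
    * by rewrite mulrA.
    * apply: ord3P; rewrite mxE /= ?scale1r ?subrr //.
      have -> : ('X_i2 - (r * r') *: 'X_i0) * (h2 * (h1 * a)) =
        ('X_i2 - r *: 'X_i1) * (h2 * (h1 * a)) +
        (r%:MP) * (('X_i1 - r' *: 'X_i0) * (h2 * (h1 * a))).
        by rewrite -!mul_mpolyC rmorphM /=; ring.
      case: l1' => N1 H1; case: l2 => N2 H2; exists (maxn N1 N2) => n g.
      rewrite geq_max => /andP[le1 le2] hg; rewrite mulrDr [X in _ + X]mulrCA.
      case: HI => _ ID IM; apply: ID; first exact: (H1 n).
      by apply: IM; apply: (H2 n).
Qed.

End Ideals.

(** * Codimensions of subspaces under linear maps *)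

Section LinearAlgebra.
Variable K : fieldType.
Implicit Types V W : vectType K.

Lemma linear_hom V W (F : V -> W) : linear F -> exists f : 'Hom(V, W), f =1 F.
Proof.
move=> HF; pose Fl : {linear V -> W} := HB.pack F (GRing.isLinear.Build _ _ _ _ F HF).
by exists (linfun Fl) => u; rewrite lfunE.
Qed.

(** Among the subspaces contained in P take one of maximal dimension; adjoining the line of any
    vector of P cannot enlarge it. *)
Lemma subspace_vspace V (P : V -> Prop) : P 0 ->
  (forall c u v, P u -> P v -> P (c *: u + v)) ->
  exists U : {vspace V}, forall u, u \in U <-> P u.
Proof.
move=> P0 Plin.
pose Q n := `[< exists U : {vspace V}, \dim U = n /\ forall u, u \in U -> P u >].
have Qex : exists n, Q n.
  exists 0%N; apply/asboolP; exists 0%VS; rewrite dimv0; split => // u.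
  by rewrite memv0 => /eqP->.
have Qle n : Q n -> (n <= \dim {:V})%N.
  by move=> /asboolP[U [<- _]]; rewrite dimvS ?subvf.
case: (ex_maxnP Qex Qle) => n /asboolP[U [dU HU]] max.
exists U => u; split; first exact: HU.
move=> Pu; suff -> : U = (<[u]> + U)%VS by rewrite (subvP (addvSl _ _)) ?memv_line.
apply/eqP; rewrite eqEdim addvSr /= dU; apply: max; apply/asboolP.
exists (<[u]> + U)%VS; split => // w /memv_addP[_ /vlineP[c ->] [v Uv ->]].
by apply: Plin => //; apply: HU.
Qed.

Definition codimv V (U : {vspace V}) := (\dim {:V} - \dim U)%N.

Lemma codimvK V (U : {vspace V}) : (\dim U + codimv U)%N = \dim {:V}.
Proof. by rewrite subnKC // dimvS ?subvf. Qed.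

Lemma codimvS V (U U' : {vspace V}) : (U <= U')%VS -> (codimv U' <= codimv U)%N.
Proof. by move=> /dimvS le; rewrite leq_sub2l. Qed.

Lemma codimvS_eq V (U U' : {vspace V}) : (U <= U')%VS ->
  codimv U' = codimv U -> U = U'.
Proof.
move=> le E; apply/eqP; rewrite eqEdim le /=.
have := codimvK U; have := codimvK U'; lia.
Qed.

Lemma codimv_cap V (U U' : {vspace V}) : (U + U' = fullv)%VS ->
  codimv (U :&: U') = (codimv U + codimv U')%N.
Proof.
move=> E; have := dimv_sum_cap U U'; rewrite E.
have := codimvK U; have := codimvK U'; have := codimvK (U :&: U'); lia.
Qed.

(** The quotient V / f^-1(U) embeds in W / U with cokernel W / (im f + U). *)
Lemma codimv_preim V W (f : 'Hom(V, W)) (U : {vspace W}) :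
  (\dim {:W} - \dim (limg f + U) + codimv (f @^-1: U))%N = codimv U.
Proof.
have Ecap : (f @: (f @^-1: U) = U :&: limg f)%VS.
  by rewrite -lpreim_cap_limg lpreimK // capvSr.
have := limg_ker_dim f (f @^-1: U); rewrite Ecap.
have -> : (f @^-1: U :&: lker f = lker f)%VS.
  by apply/capv_idPr; rewrite -lpreim0 lpreimS ?sub0v.
have := limg_ker_dim f fullv; rewrite capfv.
have := dimv_sum_cap U (limg f); rewrite (addvC U).
have := codimvK U; have := codimvK (f @^-1: U).
have : (\dim (limg f + U) <= \dim {:W})%N by rewrite dimvS ?subvf.
lia.
Qed.

Section Induced.
Variables (V W : vectType K) (f : 'Hom(V, W)) (U : {vspace V}) (U' : {vspace W}).

(** This lemma and the next three concern the map V / U -> W / U' induced by f: an injective one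
    cannot lower the dimension, a surjective one cannot raise it, and between equal dimensions
    either property gives the other. *)
Lemma codimv_inj_le : (forall u, f u \in U' -> u \in U) -> (codimv U <= codimv U')%N.
Proof.
move=> H; rewrite -(codimv_preim f) (leq_trans _ (leq_addl _ _)) // codimvS //.
by apply/subvP => u; rewrite -memv_preim; apply: H.
Qed.

Lemma codimv_inj_eq : (forall u, f u \in U' -> u \in U) -> codimv U = codimv U' ->
  (limg f + U')%VS = fullv.
Proof.
move=> H E; apply/eqP; rewrite eqEdim subvf /=.
have : (codimv U <= codimv (f @^-1: U'))%N.
  by rewrite codimvS //; apply/subvP => u; rewrite -memv_preim; apply: H.
have := codimv_preim f U'; rewrite -E; lia.
Qed.

Lemma codimv_surj_le : (limg f + U')%VS = fullv ->
  (forall u, u \in U -> f u \in U') -> (codimv U' <= codimv U)%N.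
Proof.
move=> E H; rewrite -(codimv_preim f) E subnn add0n codimvS //.
by apply/subvP => u /H; rewrite memv_preim.
Qed.

Lemma codimv_surj_eq : (limg f + U')%VS = fullv ->
  (forall u, u \in U -> f u \in U') -> codimv U' = codimv U ->
  forall u, f u \in U' -> u \in U.
Proof.
move=> E H EC u; rewrite memv_preim; suff -> : U = (f @^-1: U')%VS by [].
apply: codimvS_eq; first by apply/subvP => v /H; rewrite memv_preim.
by rewrite -EC -[RHS](codimv_preim f) E subnn.
Qed.

End Induced.

Lemma codimv_dependent V (U : {vspace V}) c (e : 'I_c.+1 -> V) : (codimv U <= c)%N ->
  exists t : 'I_c.+1 -> K, (exists i, t i != 0) /\ \sum_i t i *: e i \in U.
Proof.
move=> le; have [|f fE] := @linear_hom 'rV[K]_c.+1 V (fun t => \sum_i t 0 i *: e i).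
  move=> a s t; rewrite scaler_sumr -big_split /=; apply: eq_bigr => i _.
  by rewrite !mxE scalerDl scalerA.
have : (0 < \dim (f @^-1: U))%N.
  have := codimv_preim f U; have := codimvK (f @^-1: U)%VS.
  rewrite [X in _ = X]dimvf /dim /= mul1n; lia.
rewrite lt0n dimv_eq0 -vpick0 => t0; exists (fun i => vpick (f @^-1: U)%VS 0 i).
split; last by rewrite -fE memv_preim memv_pick.
apply: contrapT => /forallNP H; case/eqP: t0; apply/rowP => i.
by rewrite mxE; apply/eqP/negPn/negP/H.
Qed.

End LinearAlgebra.

Lemma nondecreasing_bounded_stable (u : nat -> nat) c :
  (forall k, u k <= u k.+1)%N -> (forall k, u k <= c)%N ->
  exists n k0, forall k, (k0 <= k)%N -> u k = n.
Proof.
move=> incr bnd.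
have mono k l : (k <= l)%N -> (u k <= u l)%N.
  by elim: l => [|l IH]; [rewrite leqn0 => /eqP-> | rewrite leq_eqVlt ltnS =>
    /predU1P[->//|/IH/leq_trans]; apply].
pose Q n := `[< exists k, u k = n >].
have Qex : exists n, Q n by exists (u 0%N); apply/asboolP; exists 0%N.
have Qle n : Q n -> (n <= c)%N by move=> /asboolP[k <-].
case: (ex_maxnP Qex Qle) => n /asboolP[k0 E] max; exists n, k0 => k le.
by apply/eqP; rewrite eqn_leq -{2}E mono // andbT max //; apply/asboolP; exists k.
Qed.

Lemma nonincreasing_stable (u : nat -> nat) k1 :
  (forall k, (k1 <= k)%N -> (u k.+1 <= u k)%N) ->
  exists n k0, forall k, (k0 <= k)%N -> u k = n.
Proof.
move=> decr; have mono k : (u (k1 + k) <= u k1)%N.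
  elim: k => [|k IH]; first by rewrite addn0.
  by rewrite addnS (leq_trans (decr _ _)) // leq_addr.
have [k|k|n [k0 E]] := @nondecreasing_bounded_stable (fun k => u k1 - u (k1 + k)%N)%N (u k1).
- by rewrite leq_sub2l // addnS decr // leq_addr.
- exact: leq_subr.
exists (u k1 - n)%N, (k1 + k0)%N => k le.
by rewrite -(E (k - k1)%N) ?leq_subRL ?(leq_trans (leq_addr _ _) le) //
  subKn ?subnKC // ?mono ?(leq_trans (leq_addr _ _) le) //;
  rewrite -{1}(subnKC (leq_trans (leq_addr _ _) le)) mono.
Qed.

(** * Graded pieces and Hilbert functions *)

Section GradedPieces.
Variable K : numClosedFieldType.
Local Notation S := {mpoly K[3]}.
Implicit Types (I : S -> Prop).

Lemma dhomog_hom (V : vectType K) k (F : V -> S) : linear F ->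
  (forall u, F u \is k.-homog) ->
  exists f : 'Hom(V, dhomog 3 K k), forall u, val (f u) = F u.
Proof.
move=> HF hF; have [|f fE] := @linear_hom _ V (dhomog 3 K k) (fun u => DHomog (hF u)).
  by move=> c u v; apply: val_inj => /=; rewrite HF.
by exists f => u; rewrite fE.
Qed.

Lemma mul_hom e h k : h \is e.-homog ->
  exists f : 'Hom(dhomog 3 K k, dhomog 3 K (e + k)), forall u, val (f u) = h * val u.
Proof.
move=> hh; apply: dhomog_hom => [c u v|u].
  by rewrite /= mulrDr scalerAr.
by apply: dhomogM => //; apply: dhomog_is_dhomog.
Qed.

(** The subspace is determined by its members. For an ideal it exists by [subspace_vspace], so the
    default 0 is never taken. *)
Definition piece I k : {vspace dhomog 3 K k} :=
  xget 0%VS [set U : {vspace dhomog 3 K k} |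
    forall u : dhomog 3 K k, u \in U <-> I (val u)]%classic.

Lemma mem_piece I k u : ideal I -> u \in piece I k <-> I (val u).
Proof.
move=> HI; rewrite /piece; case: xgetP => [U _ /(_ u)//|].
have [||U HU] := @subspace_vspace _ (dhomog 3 K k) (fun u => I (val u)).
- by case: HI.
- move=> c v w Iv Iw /=; have [_ ID _] := HI; apply: ID => //.
  exact: idealZ.
by move=> /(_ U).
Qed.

Definition hilbert I k := codimv (piece I k).

(** The finitely many degrees below k0 only add a constant to the bound. *)
Lemma hilbert_bounded I c k0 : ideal I -> (forall k, (k0 <= k)%N -> (hilbert I k <= c)%N) ->
  exists c', bounded_by I c' /\ forall k, (hilbert I k <= c')%N.
Proof.
move=> HI H; pose c' := (c + \sum_(k < k0) hilbert I k)%N.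
have le k : (hilbert I k <= c')%N.
  have [/H|lt] := leqP k0 k; first by move=> /leq_trans; apply; apply: leq_addr.
  by rewrite /c' (bigD1 (Ordinal lt)) //= addnCA leq_addr.
exists c'; split => // k e he.
have [t [t0 It]] := @codimv_dependent K _ (piece I k) c' (fun i => DHomog (he i)) (le k).
exists t; split => //; move: It => /(mem_piece _ HI).
by rewrite linear_sum /=.
Qed.

End GradedPieces.

(** * Local multiplicities *)

Section LocalGlobal.
Variable K : numClosedFieldType.
Local Notation S := {mpoly K[3]}.
Implicit Types (I : S -> Prop) (p q : 'rV[K]_3).

(* The forms whose germ at p lies in the localization of I at p. *)
Definition local_ideal I p (a : S) : Prop :=
  exists e b, [/\ b \is e.-homog, b.@[p 0] != 0 & I (b * a)].

Lemma local_ideal_ideal I p : ideal I -> ideal (local_ideal I p).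
Proof.
move=> [I0 ID IM]; split.
- by exists 0%N, 1; rewrite mulr0 meval1 oner_neq0 dhomog1.
- move=> a b [e [u [hu up Iu]]] [e' [v [hv vp Iv]]].
  exists (e + e')%N, (u * v); rewrite dhomogM // mevalM mulf_neq0 //; split => //.
  by rewrite mulrDr; apply: ID; [rewrite mulrAC mulrC|rewrite -mulrA]; apply: IM.
- move=> a b [e [u [hu up Iu]]]; exists e, u; split => //.
  by rewrite mulrCA; apply: IM.
Qed.

Lemma local_ideal_sub I p a : I a -> local_ideal I p a.
Proof. by exists 0%N, 1; rewrite dhomog1 meval1 oner_neq0 mul1r. Qed.

Lemma local_ideal_cancel I p e b a : b \is e.-homog -> b.@[p 0] != 0 ->
  local_ideal I p (b * a) -> local_ideal I p a.
Proof.
move=> hb bp [e' [u [hu up Iu]]]; exists (e' + e)%N, (u * b).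
by rewrite dhomogM // mevalM mulf_neq0 // -mulrA.
Qed.

Lemma hilbert_mono I J k : ideal I -> ideal J -> (forall a, I a -> J a) ->
  (hilbert J k <= hilbert I k)%N.
Proof.
move=> HI HJ IJ; apply: codimvS; apply/subvP => u /(mem_piece _ HI)/IJ.
by move/(mem_piece _ HJ).
Qed.

Lemma plane_coord p : proj_plane p -> exists i, p 0 i = 1.
Proof. by move=> [i [pi _]]; exists i. Qed.

(** A coordinate X_i with p_i = 1 acts injectively on S / I_p, so the Hilbert function is
    nondecreasing; it is bounded by that of S / I. *)
Lemma hilbert_local_stable I c p : ideal I -> (forall k, hilbert I k <= c)%N ->
  proj_plane p ->
  exists n k0, forall k, (k0 <= k)%N -> hilbert (local_ideal I p) k = n.
Proof.
move=> HI Hc /plane_coord[i pi]; have HQ := local_ideal_ideal p HI.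
apply: (@nondecreasing_bounded_stable _ c) => k; last first.
  by apply: leq_trans (Hc k); apply: hilbert_mono => // a; apply: local_ideal_sub.
have [f fE] := mul_hom k (dhomog_U K i).
apply: (codimv_inj_le (f := f)) => u /(mem_piece _ HQ); rewrite fE.
move=> /local_ideal_cancel H; apply/(mem_piece _ HQ); apply: H (dhomog_U K i) _.
by rewrite mevalXU pi oner_neq0.
Qed.

(** Multiplication by b is injective modulo I_p because b does not vanish at p, and the dimensions
    in the two degrees are equal. *)
Lemma local_mul_surj I p n k0 e b k : ideal I ->
  (forall k, (k0 <= k)%N -> hilbert (local_ideal I p) k = n) ->
  b \is e.-homog -> b.@[p 0] != 0 -> (k0 <= k)%N ->
  forall f : 'Hom(dhomog 3 K k, dhomog 3 K (e + k)),
  (forall u, val (f u) = b * val u) ->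
  (limg f + piece (local_ideal I p) (e + k))%VS = fullv.
Proof.
move=> HI Hn hb bp le f fE; have HQ := local_ideal_ideal p HI.
apply: (codimv_inj_eq (U := piece (local_ideal I p) k)).
  move=> u /(mem_piece _ HQ); rewrite fE => /(local_ideal_cancel hb bp).
  by move/(mem_piece _ HQ).
rewrite -!/(hilbert _ _) !Hn //; exact: leq_trans le (leq_addl _ _).
Qed.

(** The c + 1 forms l^j X_i^(c-j) satisfy a relation modulo I. Factoring out the smallest power l^j
    that occurs leaves a cofactor whose value at p is the coefficient t_j, because l(p) = 0. *)
Lemma local_nilpotent I c p (l : S) : ideal I -> bounded_by I c -> proj_plane p ->
  l \is 1.-homog -> l.@[p 0] = 0 -> exists n, local_ideal I p (l ^+ n).
Proof.
move=> HI Hb /plane_coord[i pi] hl lp.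
have hX j m : l ^+ j * 'X_i ^+ m \is (j + m).-homog.
  by have := dhomogM (dhomogMn j hl) (dhomogMn m (dhomog_U K i)); rewrite !mul1n.
have [|t [[j0 tj0] It]] := Hb c (fun j : 'I_c.+1 => l ^+ j * 'X_i ^+ (c - j)).
  by move=> j; have := hX j (c - j)%N; rewrite subnKC // -ltnS.
pose P j := (j <= c)%N && (t (inord j) != 0).
have Pex : exists j, P j by exists j0; rewrite /P inord_val tj0 -ltnS ltn_ord.
case: (ex_minnP Pex) => j /andP[lejc tj] jmin.
exists j; pose b := \sum_(m < c.+1 | (j <= m)%N) t m *: (l ^+ (m - j) * 'X_i ^+ (c - m)).
exists (c - j)%N, b; split.
- apply: rpred_sum => m lem; apply: rpredZ.
  have := hX (m - j)%N (c - m)%N; have := ltn_ord m; rewrite ltnS => lemc.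
  by suff -> : (m - j + (c - m) = c - j)%N by []; lia.
- rewrite /b (bigD1 (inord j)) ?inordK //= raddfD raddf_sum /= big1 => [|m /andP[lem ne]].
    rewrite addr0 mevalZ mevalM !rmorphXn /= mevalXU pi ?inordK //.
    by rewrite subnn expr0 expr1n !mulr1.
  rewrite mevalZ mevalM rmorphXn /= lp expr0n subn_eq0.
  rewrite leqNgt ltn_neqAle lem andbT negbK.
  suff -> : (j == m :> nat) = false by rewrite /= mul0r mulr0.
  by apply: contraNF ne => /eqP E; apply/eqP/val_inj; rewrite /= inordK.
- move: It; congr (I _); rewrite /b mulr_suml [LHS](bigID (fun m : 'I_c.+1 => (j <= m)%N)) /=.
  rewrite [X in _ + X]big1 ?addr0 => [|m nle]; last first.
    suff -> : t m = 0 by rewrite scale0r.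
    apply/eqP; apply: contraNT nle => tm; apply: jmin.
    by rewrite /P inord_val tm -ltnS ltn_ord.
  apply: eq_bigr => m lem; rewrite -scalerAl mulrAC -exprD subnK //.
Qed.

(** If every X_j - p_j X_i, where p_i = 1, vanishes at q, then q = q_i p, and the normalization of
    the points gives q = p. *)
Lemma separating_form p q : @proj_plane K p -> @proj_plane K q -> p != q ->
  exists l : S, [/\ l \is 1.-homog, l.@[p 0] = 0 & l.@[q 0] != 0].
Proof.
move=> [i [pi pj]] [i' [qi qj]] ne; apply: contrapT => H.
have E j : q 0 j = p 0 j * q 0 i.
  apply/eqP/negPn/negP => nE; apply: H; exists ('X_j - p 0 j *: 'X_i); split.
  - by rewrite rpredB ?rpredZ ?dhomog_U.
  - by rewrite mevalB mevalZ !mevalXU pi mulr1 subrr.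
  - by rewrite mevalB mevalZ !mevalXU subr_eq0.
case/eqP: ne; apply/rowP => j; rewrite E.
suff -> : q 0 i = 1 by rewrite mulr1.
have [lt|gt|eq] := ltngtP i i'.
- by have := E i'; rewrite (qj _ lt) mulr0 qi => /eqP; rewrite oner_eq0.
- by have := E i'; rewrite (pj _ gt) mul0r qi => /eqP; rewrite oner_eq0.
- by have -> : i = i' by apply: val_inj.
Qed.

Lemma separating_product I c (ps : seq 'rV[K]_3) p : ideal I -> bounded_by I c ->
  {in ps, forall q, proj_plane q} -> proj_plane p -> p \notin ps ->
  exists e h, [/\ h \is e.-homog, h.@[p 0] != 0 &
    {in ps, forall q, local_ideal I q h}].
Proof.
move=> HI Hb; elim: ps => [|q ps IH] Hps Hp.
  by exists 0%N, 1; rewrite dhomog1 meval1 oner_neq0.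
rewrite inE negb_or => /andP[npq nps].
have [|e [h [hh hp hps]]] := IH _ Hp nps.
  by move=> r rps; apply: Hps; rewrite inE rps orbT.
have Hq : proj_plane q by apply: Hps; rewrite inE eqxx.
have nqp : q != p by rewrite eq_sym.
have [l [hl lq lp]] := separating_form Hq Hp nqp.
have [n ln] := local_nilpotent HI Hb Hq hl lq.
exists (1 * n + e)%N, (l ^+ n * h); split.
- by apply: dhomogM => //; apply: dhomogMn.
- by rewrite mevalM rmorphXn mulf_neq0 // expf_neq0.
move=> r; rewrite inE => /predU1P[->|rps].
  by rewrite mulrC; case: (local_ideal_ideal q HI) => _ _; apply.
by case: (local_ideal_ideal r HI) => _ _; apply; apply: hps.
Qed.

Definition local_cap I (ps : seq 'rV[K]_3) a := {in ps, forall p, local_ideal I p a}.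

Lemma local_cap_ideal I ps : ideal I -> ideal (local_cap I ps).
Proof.
move=> HI; split.
- by move=> p _; case: (local_ideal_ideal p HI).
- by move=> a b Ha Hb p pps; case: (local_ideal_ideal p HI) => _ ID _; apply: ID; auto.
- by move=> a b Hb p pps; case: (local_ideal_ideal p HI) => _ _; apply; apply: Hb.
Qed.

(** Chinese remainder theorem: a form h that is nonzero at p and lies in I_q for all other points q
    acts surjectively on S / I_p in large degrees, so I_p and the intersection of the I_q together
    span everything there, and codimensions add. *)
Lemma hilbert_local_cap I c (n : 'rV[K]_3 -> nat) (ps : seq 'rV[K]_3) :
  ideal I -> bounded_by I c -> uniq ps ->
  {in ps, forall p, proj_plane p} ->
  {in ps, forall p, exists k0, forall k, (k0 <= k)%N -> hilbert (local_ideal I p) k = n p} ->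
  exists k0, forall k, (k0 <= k)%N -> hilbert (local_cap I ps) k = (\sum_(p <- ps) n p)%N.
Proof.
move=> HI Hb; elim: ps => [_ _ _|p ps IH] /=.
  exists 0%N => k _; rewrite big_nil /hilbert.
  suff -> : piece (local_cap I [::]) k = fullv by rewrite /codimv subnn.
  apply/vspaceP => u; rewrite memvf; apply/(mem_piece _ (local_cap_ideal _ HI)).
  by [].
move=> /andP[nps ups] Hps Hn.
have Hps' : {in ps, forall p, proj_plane p} by move=> r rps; apply: Hps; rewrite inE rps orbT.
have Hp : proj_plane p by apply: Hps; rewrite inE eqxx.
have [|k1 H1] := IH ups Hps'.
  by move=> r rps; apply: Hn; rewrite inE rps orbT.
have [k2 H2] := Hn p (mem_head _ _).
have [e [h [hh hp hps]]] := separating_product HI Hb Hps' Hp nps.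
exists (e + (k1 + k2))%N => k le; rewrite big_cons.
rewrite -(H1 k) -?(H2 k); [|lia..].
rewrite /hilbert -codimv_cap.
  congr codimv; apply/vspaceP => u; rewrite memv_cap.
  apply/idP/andP => [/(mem_piece _ (local_cap_ideal _ HI)) H|[]].
    split; first by apply/(mem_piece _ (local_ideal_ideal _ HI))/H/mem_head.
    apply/(mem_piece _ (local_cap_ideal _ HI)) => r rps; apply: H.
    by rewrite inE rps orbT.
  move=> /(mem_piece _ (local_ideal_ideal _ HI)) Hu /(mem_piece _ (local_cap_ideal _ HI)) Hu'.
  apply/(mem_piece _ (local_cap_ideal _ HI)) => r; rewrite inE => /predU1P[->//|].
  exact: Hu'.
have ke : k = (e + (k - e))%N by lia.
rewrite ke; have [f fE] := mul_hom (k - e) hh.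
have Hsurj := local_mul_surj HI H2 hh hp _ fE.
apply/eqP; rewrite eqEdim subvf /= -Hsurj; last lia.
rewrite dimvS // addvC addvS //; apply/subvP => _ /memv_imgP[u _ ->].
apply/(mem_piece _ (local_cap_ideal _ HI)); rewrite fE mulrC.
by case: (local_cap_ideal ps HI) => _ _; apply.
Qed.

Definition base_locus I : set 'rV[K]_3 :=
  [set p | proj_plane p /\ forall e b, b \is e.-homog -> I b -> b.@[p 0] = 0]%classic.

Lemma hilbert_local_gt0 I p k : ideal I -> base_locus I p ->
  (0 < hilbert (local_ideal I p) k)%N.
Proof.
move=> HI [/plane_coord[i pi] Hp]; have HQ := local_ideal_ideal p HI.
have hX : 'X_i ^+ k \is [in K[3], k.-homog].
  by have := dhomogMn k (dhomog_U K i); rewrite mul1n.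
rewrite lt0n; apply/eqP => h0; have : piece (local_ideal I p) k = fullv.
  by apply: codimvS_eq; rewrite ?subvf // -/(hilbert _ _) h0 /codimv subnn.
move/vspaceP => /(_ (DHomog hX)); rewrite memvf => /(mem_piece _ HQ) /= [e [b [hb bp]]].
move=> /(Hp _ _ (dhomogM hb hX)); rewrite mevalM rmorphXn /= mevalXU pi expr1n mulr1.
by move/eqP: bp.
Qed.

(** By the preceding sum each point of the base locus contributes at least 1 to a Hilbert function
    bounded by c. A list of maximal length therefore exists and contains every base point. *)
Lemma base_locus_finite I c : ideal I -> bounded_by I c ->
  (forall k, hilbert I k <= c)%N ->
  exists ps : seq 'rV[K]_3, uniq ps /\ forall p, p \in ps <-> base_locus I p.
Proof.
move=> HI Hb Hc.
pose Q n := `[< exists ps, [/\ uniq ps, {in ps, forall p, base_locus I p} & size ps = n] >].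
have Qex : exists n, Q n by exists 0%N; apply/asboolP; exists [::].
have Qle n : Q n -> (n <= c)%N.
  move=> /asboolP[ps [ups Hps <-]].
  have Hpl : {in ps, forall p, proj_plane p} by move=> p /Hps[].
  have /choice[nn Hnn] : forall p, exists n, p \in ps ->
     exists k0, forall k, (k0 <= k)%N -> hilbert (local_ideal I p) k = n.
    move=> p; have [pps|] := boolP (p \in ps); last by exists 0%N.
    by have [m Hm] := hilbert_local_stable HI Hc (Hpl _ pps); exists m.
  have [k0 Hk0] := hilbert_local_cap HI Hb ups Hpl Hnn.
  apply: leq_trans (Hc k0).
  have le1 : (hilbert (local_cap I ps) k0 <= hilbert I k0)%N.
    apply: hilbert_mono => //; first exact: local_cap_ideal.
    by move=> a Ia p _; apply: local_ideal_sub.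
  apply: leq_trans le1; rewrite Hk0 // -sum1_size big_seq [X in (_ <= X)%N]big_seq.
  apply: leq_sum => p pps; have [k1 Hk1] := Hnn p pps.
  by rewrite -(Hk1 k1) // hilbert_local_gt0 //; apply: Hps.
case: (ex_maxnP Qex Qle) => n /asboolP[ps [ups Hps sps]] max.
exists ps; split => // p; split; first exact: Hps.
move=> Hp; apply: contrapT => /negP nps.
have : Q n.+1.
  apply/asboolP; exists (p :: ps); rewrite /= nps ups sps; split => // q.
  by rewrite inE => /predU1P[->//|/Hps].
by move/max; rewrite ltnn.
Qed.

(** For the forms X_0 + t X_1 + t^2 X_2 the value at each point is a nonzero polynomial in t, and
    the product of these has finitely many roots. *)
Lemma avoiding_form (ps : seq 'rV[K]_3) : {in ps, forall p, proj_plane p} ->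
  exists l : S, l \is 1.-homog /\ {in ps, forall p, l.@[p 0] != 0}.
Proof.
move=> Hps.
pose F (p : 'rV[K]_3) : {poly K} := \poly_(j < 3) p 0 (inord j).
have F0 p : proj_plane p -> F p != 0.
  move=> /plane_coord[i pi]; apply/eqP => E.
  have := coef_poly 3 (fun j => p 0 (inord j)) i.
  by rewrite -/(F p) E coef0 ltn_ord inord_val pi => /eqP; rewrite eq_sym oner_eq0.
have [t Ht] : exists t : K, (\prod_(p <- ps) F p).[t] != 0.
  apply: contrapT => /forallNP H.
  pose G := \prod_(p <- ps) F p; have G0 : G != 0.
    by rewrite /G prodf_seq_neq0; apply/allP => p /Hps/F0.
  have : (size [seq i%:R : K | i <- iota 0 (size G)] < size G)%N.
    apply: max_poly_roots => //; first by apply/allP => x _; apply/negPn/negP/H.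
    by rewrite map_inj_uniq ?iota_uniq // => i j /eqP; rewrite eqr_nat => /eqP.
  by rewrite size_map size_iota ltnn.
exists (\sum_(j < 3) t ^+ j *: 'X_j); split.
  by apply: rpred_sum => j _; rewrite rpredZ ?dhomog_U.
move=> p pps; move: Ht; rewrite horner_prod prodf_seq_neq0 => /allP/(_ _ pps) /=.
congr (is_true (_ != _)); rewrite horner_poly raddf_sum /=; apply: eq_bigr => j _.
by rewrite mevalZ mevalXU inord_val mulrC.
Qed.

End LocalGlobal.

(** * The Hilbert function as a sum of local contributions *)

Section HilbertSum.
Variable K : numClosedFieldType.
Local Notation S := {mpoly K[3]}.
Implicit Types (I : S -> Prop).

Lemma pihomogM n (R : comNzRingType) (v g : {mpoly R[n]}) e k : g \is e.-homog ->
  pihomog mdeg (k + e) (v * g) = pihomog mdeg k v * g.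
Proof.
move=> hg; rewrite [v]mpolyE mulr_suml !raddf_sum /= mulr_suml.
apply: eq_bigr => m _; rewrite -scalerAl !linearZ /= -scalerAl; congr (_ *: _).
have hX : 'X_[m] \is [in R[n], (mdeg m).-homog] by rewrite dhomogX.
have [<-|ne] := eqVneq (mdeg m) k.
  by rewrite !pihomog_dE //; apply: dhomogM.
rewrite (pihomog_ne0 ne hX) mul0r (pihomog_ne0 _ (dhomogM hX hg)) //.
by rewrite eqn_add2r.
Qed.

Lemma pihomogM_lt n (R : comNzRingType) (v g : {mpoly R[n]}) e k : g \is e.-homog ->
  (k < e)%N -> pihomog mdeg k (v * g) = 0.
Proof.
move=> hg lt; rewrite [v]mpolyE mulr_suml raddf_sum big1 //= => m _.
rewrite -scalerAl linearZ /=.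
have hX : 'X_[m] \is [in R[n], (mdeg m).-homog] by rewrite dhomogX.
rewrite (pihomog_ne0 _ (dhomogM hX hg)) ?scaler0 //.
by rewrite gtn_eqF // (leq_trans lt) // leq_addl.
Qed.

Definition homogeneous_ideal I := forall a k, I a -> I (pihomog mdeg k a).

Definition add_principal I (l : S) a := exists u v, I u /\ a = u + v * l.

Lemma add_principal_ideal I l : ideal I -> ideal (add_principal I l).
Proof.
move=> [I0 ID IM]; split.
- by exists 0, 0; rewrite mul0r addr0.
- move=> _ _ [u [v [Iu ->]]] [u' [v' [Iu' ->]]]; exists (u + u'), (v + v').
  by split; [exact: ID|ring].
- move=> a _ [u [v [Iu ->]]]; exists (a * u), (a * v).
  by split; [exact: IM|ring].
Qed.

(* A linear form without zeros on the base locus is surjective, hence bijective,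
   on S / I in large degrees. *)
Lemma saturated_eventually I c : ideal I -> homogeneous_ideal I -> bounded_by I c ->
  (forall k, hilbert I k <= c)%N ->
  exists k0, forall k a, (k0 <= k)%N -> a \is k.-homog -> saturation I a -> I a.
Proof.
move=> HI HH Hb Hc; have [I0 ID IM] := HI.
have [ps [ups psP]] := base_locus_finite HI Hb Hc.
have [|l [hl lP]] := @avoiding_form K ps; first by move=> p /psP[].
have HJ := add_principal_ideal l HI.
have IJ a : I a -> add_principal I l a by exists a, 0; rewrite mul0r addr0.
have bJ : bounded_by (add_principal I l) c.
  by move=> k e /Hb[t [t0 /IJ It]]; exists t.
(* Since I + (l) has no zeros, 1 lies in its saturation: all forms of degree at least N lie in I +
   (l). *)
have [|N HN] := projective_nullstellensatz HJ bJ (dhomog1 K (@mdeg 3)).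
  move=> p pp Hp; have : p \in ps.
    by apply/psP; split => // e b hb Ib; apply: (Hp e) => //; apply: IJ.
  move=> /lP; rewrite (Hp 1%N l hl) ?eqxx //.
  by exists 0, 1; rewrite mul1r add0r.
have surj k : (N <= k)%N -> exists f : 'Hom(dhomog 3 K k, dhomog 3 K (1 + k)),
    (forall u, val (f u) = l * val u) /\ (limg f + piece I (1 + k))%VS = fullv.
  move=> le; have [f fE] := mul_hom k hl; exists f; split => //.
  apply/vspaceP => u; rewrite memvf; have hu := dhomog_is_dhomog u.
  have [||x [v [Ix E]]] := HN (1 + k)%N (val u) => //; first exact: leq_trans le (leq_addl _ _).
  apply/memv_addP.
  have hv := pihomogP mdeg k v; have hx := pihomogP mdeg (1 + k) x.
  exists (f (DHomog hv)); first by rewrite memv_img ?memvf.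
  exists (DHomog hx); first by apply/(mem_piece _ HI)/HH.
  apply: val_inj; rewrite linearD /= fE /= mulrC -(pihomogM _ _ hl) addrC.
  by rewrite (addnC k) -linearD /= -E mulr1 pihomog_dE.
have lI k u (f : 'Hom(dhomog 3 K k, dhomog 3 K (1 + k))) :
    (forall u, val (f u) = l * val u) -> u \in piece I k -> f u \in piece I (1 + k).
  move=> fE /(mem_piece _ HI) Iu; apply/(mem_piece _ HI); rewrite fE.
  exact: IM.
(* Surjectivity makes the Hilbert function nonincreasing from degree N on, hence eventually
   constant; there l is injective as well. *)
have [|n [k0 Hk0]] := @nonincreasing_stable (hilbert I) N.
  move=> k /surj[f [fE fS]]; apply: (codimv_surj_le fS) => u; exact: lI.
have inj k a : (N + k0 <= k)%N -> a \is k.-homog -> I (l * a) -> I a.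
  move=> le ha Ila; have [f [fE fS]] := surj k (leq_trans (leq_addr _ _) le).
  have le0 : (k0 <= k)%N := leq_trans (leq_addl _ _) le.
  have /(mem_piece _ HI) // : DHomog ha \in piece I k.
  apply: (codimv_surj_eq fS) => [u||]; first exact: lI.
    by rewrite -!/(hilbert _ _) !Hk0 // ltnW.
  by apply/(mem_piece _ HI); rewrite fE.
exists (N + k0)%N => k a le ha [M HM].
have hlM j : l ^+ j \is j.-homog by have := dhomogMn j hl; rewrite mul1n.
have := HM M (l ^+ M) (leqnn _) (hlM M); elim: M {HM} => [|M IH].
  by rewrite mul1r.
rewrite exprS -mulrA => /inj H; apply: IH; apply: H (dhomogM (hlM M) ha).
exact: leq_trans le (leq_addl _ _).
Qed.

Theorem hilbert_local_sum I c : ideal I -> homogeneous_ideal I -> bounded_by I c ->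
  (forall k, hilbert I k <= c)%N ->
  exists (ps : seq 'rV[K]_3) (n : 'rV[K]_3 -> nat), [/\ uniq ps,
    forall p, p \in ps <-> base_locus I p,
    {in ps, forall p, exists k0, forall k, (k0 <= k)%N -> hilbert (local_ideal I p) k = n p} &
    exists k0, forall k, (k0 <= k)%N -> hilbert I k = (\sum_(p <- ps) n p)%N].
Proof.
move=> HI HH Hb Hc; have [ps [ups psP]] := base_locus_finite HI Hb Hc.
have Hpl : {in ps, forall p, proj_plane p} by move=> p /psP[].
have /choice[n Hn] : forall p, exists n, p \in ps ->
   exists k0, forall k, (k0 <= k)%N -> hilbert (local_ideal I p) k = n.
  move=> p; have [pps|] := boolP (p \in ps); last by exists 0%N.
  by have [n H] := hilbert_local_stable HI Hc (Hpl _ pps); exists n.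
exists ps, n; split => //.
have [k1 Hk1] := hilbert_local_cap HI Hb ups Hpl Hn.
have [k2 Hk2] := saturated_eventually HI HH Hb Hc.
exists (k1 + k2)%N => k le; rewrite -(Hk1 k); last exact: leq_trans (leq_addr _ _) le.
congr codimv; apply/vspaceP => u; apply/idP/idP.
  move=> /(mem_piece _ HI) Iu; apply/(mem_piece _ (local_cap_ideal _ HI)) => p _.
  exact: local_ideal_sub.
move=> /(mem_piece _ (local_cap_ideal _ HI)) Hu; apply/(mem_piece _ HI).
apply: (Hk2 k); [exact: leq_trans (leq_addl _ _) le | exact: dhomog_is_dhomog |].
apply: (projective_nullstellensatz HI Hb (dhomog_is_dhomog u)) => p pp Hp.
by apply: Hu; apply/psP.
Qed.

End HilbertSum.

(** * The Jacobian ideal and its affine charts *)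

Section Euler.
Variables (n : nat) (K : comNzRingType).

Lemma mderiv_homog d (f : {mpoly K[n]}) i : f \is d.-homog -> f^`M(i) \is d.-1.-homog.
Proof.
move=> hf; apply/dhomogP => m; rewrite mcoeff_msupp mcoeff_deriv => h.
have : (m + U_(i))%MM \in msupp f.
  by rewrite mcoeff_msupp; apply: contraNneq h => ->; rewrite mul0rn.
by move=> /(dhomog_mf hf) /=; rewrite mdegD mdeg1 addn1 => <-.
Qed.

Lemma euler_identity d (f : {mpoly K[n]}) : f \is d.-homog ->
  \sum_i 'X_i * f^`M(i) = d%:R *: f.
Proof.
move=> hf; rewrite {2}[f]mpolyE scaler_sumr.
have -> : \sum_i 'X_i * f^`M(i) =
    \sum_(m <- msupp f) \sum_i ((m i)%:R * f@_m) *: ('X_i * 'X_[m - U_(i)]).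
  rewrite exchange_big; apply: eq_bigr => i _ /=.
  by rewrite mulr_sumr; apply: eq_bigr => m _; rewrite -scalerAr.
rewrite big_seq [RHS]big_seq; apply: eq_bigr => m mf.
rewrite scalerA -(dhomog_mf hf mf) /= mdegE natr_sum mulr_suml scaler_suml.
apply: eq_bigr => i _; have [->|mi] := posnP (m i); first by rewrite !mul0r !scale0r.
rewrite -mpolyXD addmC submK //.
by rewrite lep1mP -lt0n.
Qed.

Lemma mderivU i j : ('X_j : {mpoly K[n]})^`M(i) = (j == i)%:R.
Proof.
rewrite mderivX mnm1E; case: eqP => [->|_]; last by rewrite scale0r.
suff -> : (U_(i) - U_(i))%MM = 0%MM :> 'X_{1..n} by rewrite mpolyX0 scale1r.
by apply/mnmP => k; rewrite !mnmE subnn.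
Qed.

End Euler.

Section JacobianIdeal.
Variable K : numClosedFieldType.
Local Notation S := {mpoly K[3]}.

Definition jacobian (f a : S) := exists c : 'I_3 -> S, a = \sum_j c j * f^`M(j).

Lemma jacobian_ideal f : ideal (jacobian f).
Proof.
split.
- by exists (fun=> 0); rewrite big1 // => i _; rewrite mul0r.
- move=> _ _ [c ->] [c' ->]; exists (fun j => c j + c' j).
  by rewrite -big_split; apply: eq_bigr => j _; rewrite mulrDl.
- move=> a _ [c ->]; exists (fun j => a * c j).
  by rewrite mulr_sumr; apply: eq_bigr => j _; rewrite mulrA.
Qed.

Lemma jacobian_graded d f k a : f \is d.-homog -> a \is (k + d.-1).-homog ->
  jacobian f a ->
  exists c : 'I_3 -> S, (forall j, c j \is k.-homog) /\ a = \sum_j c j * f^`M(j).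
Proof.
move=> hf ha [c E]; exists (fun j => pihomog mdeg k (c j)); split.
  by move=> j; apply: pihomogP.
rewrite -(pihomog_dE ha) E raddf_sum /=; apply: eq_bigr => j _.
by rewrite (pihomogM _ _ (mderiv_homog j hf)).
Qed.

Lemma jacobian_deriv f j : jacobian f f^`M(j).
Proof.
exists (fun i => (i == j)%:R); rewrite (bigD1 j) //= eqxx mul1r.
by rewrite big1 ?addr0 // => i /negPf ->; rewrite mul0r.
Qed.

Lemma jacobian_homogeneous d f : f \is d.-homog -> homogeneous_ideal (jacobian f).
Proof.
move=> hf a k [c ->]; rewrite raddf_sum /=; apply: ideal_sum => [|j _].
  exact: jacobian_ideal.
have hj := mderiv_homog j hf; have [I0 _ IM] := jacobian_ideal f.
have [le|lt] := leqP d.-1 k; last by rewrite (pihomogM_lt _ hj lt).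
by rewrite -(subnK le) (pihomogM _ _ hj); apply: IM; apply: jacobian_deriv.
Qed.

End JacobianIdeal.

(** * Passage to an affine chart *)

Section Dehomogenization.
Variable K : fieldType.
Local Notation S := {mpoly K[3]}.
Local Notation A := {mpoly K[2]}.
Variable i : 'I_3.

(** Names the tuple inside [dehomog], so that the morphism structures of [comp_mpoly] can be
    copied. *)
Definition chart_tuple : 3.-tuple A :=
  [tuple if unlift i j is Some k then 'X_k else 1 | j < 3].

HB.instance Definition _ :=
  GRing.RMorphism.copy (@dehomog K i) (comp_mpoly chart_tuple).
HB.instance Definition _ :=
  GRing.Linear.copy (@dehomog K i) (comp_mpoly chart_tuple).

Local Notation deh := (@dehomog K i).

Lemma dehomogC c : deh c%:MP = c%:MP.
Proof. exact: comp_mpolyC. Qed.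

Lemma dehomogU j : deh 'X_j = if unlift i j is Some k then 'X_k else 1.
Proof. by rewrite /dehomog comp_mpolyXU -tnth_nth tnth_mktuple. Qed.

Lemma dehomog_base : deh 'X_i = 1.
Proof. by rewrite dehomogU unlift_none. Qed.

Lemma dehomog_lift k : deh 'X_(lift i k) = 'X_k.
Proof. by rewrite dehomogU liftK. Qed.

Lemma dehomog_deriv k (f : S) : (deh f)^`M(k) = deh f^`M(lift i k).
Proof.
elim/mpolyind: f => [|c m f _ _ IHf]; first by rewrite raddf0 !mderiv0 raddf0.
rewrite linearP mderivD mderivZ [in RHS]mderivD mderivZ linearP IHf; congr (_ *: _ + _).
have [n] := ubnP (mdeg m); elim: n m => // n IH m /ltnSE-le.
have [->|m0] := eqVneq m 0%MM; first by rewrite mpolyX0 rmorph1 -!mpolyC1 !mderivC raddf0.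
have [j [m' Em]] := monomial_split m0.
rewrite Em mpolyXD rmorphM /= !mderivM rmorphD !rmorphM /= (IH m'); last first.
  by move: le; rewrite Em mdegD mdeg1 add1n.
congr (_ * _ + _); rewrite [in LHS]dehomogU mderivU.
case: unliftP => [l ->|->].
  by rewrite mderivU (inj_eq lift_inj) rmorph_nat.
by rewrite -mpolyC1 mderivC (negPf (neq_lift _ _)) rmorph0.
Qed.

(** Stated for values in any field L, since it serves both for evaluation at a point and for the
    generic point in the fraction field of S. *)
Lemma mmap_dehomog (L : fieldType) (phi : {rmorphism K -> L}) (h : 'I_3 -> L) e (a : S) :
  h i != 0 -> a \is e.-homog ->
  mmap phi h a = h i ^+ e * mmap phi (fun k => h (lift i k) / h i) (deh a).
Proof.
move=> hi0 ha; set g := fun k => _.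
rewrite [in LHS](mpolyE a) [in RHS](mpolyE a) (raddf_sum (mmap phi h)) (raddf_sum deh).
rewrite (raddf_sum (mmap phi g)) /= mulr_sumr.
rewrite big_seq [RHS]big_seq; apply: eq_bigr => m ma.
rewrite linearZ /= !mmapZ mulrCA; congr (_ * _).
rewrite -(dhomog_mf ha ma) /= mmapX mdegE expr_sum /mmap1.
rewrite mpolyXE_id !rmorph_prod -big_split /=; apply: eq_bigr => j _.
rewrite !rmorphXn /= -exprMn; congr (_ ^+ _).
rewrite dehomogU; case: unliftP => [k ->|->].
  by rewrite mmapX mmap1U mulrC divfK.
by rewrite rmorph1 mulr1.
Qed.

Lemma meval_dehomog (p : 'I_3 -> K) e (a : S) : p i != 0 -> a \is e.-homog ->
  a.@[p] = p i ^+ e * (deh a).@[fun k => p (lift i k) / p i].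
Proof. exact: (mmap_dehomog idfun). Qed.

(** Evaluated at the variables themselves, in the fraction field of S, [mmap_dehomog] recovers a
    from its restriction to the chart. *)
Lemma dehomog_eq0 e (a : S) : a \is e.-homog -> deh a = 0 -> a = 0.
Proof.
move=> ha E; apply/eqP; rewrite -tofrac_eq0.
pose h (j : 'I_3) : {fraction S} := tofrac 'X_j.
have Efrac : (tofrac a : {fraction S}) = mmap (@tofrac S \o @mpolyC 3 K) h a.
  move: a {ha E}; apply: mpoly_rmorph_ext => [c|j] /=; first by rewrite mmapC.
  by rewrite mmapX mmap1U.
rewrite Efrac (@mmap_dehomog _ _ _ e) ?E ?raddf0 ?mulr0 //.
by rewrite tofrac_eq0 -msize_poly_eq0 msizeX.
Qed.

(** Every large degree is allowed, so that several polynomials can be lifted to forms of prescribed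
    degrees. *)
Lemma homogenization (b : A) : exists e0, forall e, (e0 <= e)%N ->
  exists a : S, a \is e.-homog /\ deh a = b.
Proof.
pose a0 := b \mPo [tuple 'X_(lift i k) | k < 2].
have E0 : deh a0 = b.
  rewrite /a0; move: b {a0}.
  apply: (@mpoly_rmorph_ext _ _ _ (deh \o comp_mpoly [tuple 'X_(lift i k) | k < 2]) idfun) => [c|k] /=.
    by rewrite comp_mpolyC dehomogC.
  by rewrite comp_mpolyXU -tnth_nth tnth_mktuple dehomog_lift.
exists (msize a0) => e le; exists (\sum_(j < e) 'X_i ^+ (e - j) * pihomog mdeg j a0); split.
  apply: rpred_sum => j _; have hX : 'X_i \is [in K[3], 1.-homog] by rewrite dhomogX /= mdeg1.
  have := dhomogM (dhomogMn (e - j) hX) (pihomogP mdeg j a0).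
  by rewrite mul1n subnK // ltnW.
rewrite -[RHS]E0 [in RHS](pihomog_partitionE le) !raddf_sum /=.
apply: eq_bigr => j _; by rewrite rmorphM rmorphXn /= dehomog_base expr1n mul1r.
Qed.

End Dehomogenization.

(** * The local Tjurina number as a stable Hilbert value *)

Section QuotientDimension.
Variable K : fieldType.
Local Notation Frac := {fraction {mpoly K[2]}}.
Local Notation scal c := (tofrac (c%:MP : {mpoly K[2]})).

(** Expressing each family through the other gives matrices whose product is the identity, by
    uniqueness of the coordinates modulo W. *)
Lemma has_qdim_le (V W : set Frac) n n' :
  W 0 -> (forall x y, W x -> W y -> W (x + y)) ->
  (forall c x, W x -> W (scal c * x)) ->
  has_qdim V W n -> has_qdim V W n' -> (n' <= n)%N.
Proof.
move=> W0 WD WZ [e [Ve He]] [e' [Ve' He']].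
have Wsum (T : finType) (F : T -> Frac) : (forall i, W (F i)) -> W (\sum_i F i).
  by move=> H; elim/big_ind: _.
have /choice[A HA] : forall j, exists c : 'rV[K]_n, W (e' j - \sum_i scal (c 0 i) * e i).
  by move=> j; have [c [Hc _]] := He _ (Ve' j); exists c.
have /choice[B HB] : forall i, exists c : 'rV[K]_n', W (e i - \sum_j scal (c 0 j) * e' j).
  by move=> i; have [c [Hc _]] := He' _ (Ve i); exists c.
pose MA := \matrix_(j, i) A j 0 i; pose MB := \matrix_(i, j) B i 0 j.
suff /mulmx1_min : MA *m MB = 1%:M by [].
apply/row_matrixP => j; have [c [_ Hc]] := He' _ (Ve' j).
rewrite -(Hc (row j (MA *m MB))); last first.
  have -> : e' j - \sum_l scal (row j (MA *m MB) 0 l) * e' l =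
     (e' j - \sum_i scal (A j 0 i) * e i) +
     \sum_i scal (A j 0 i) * (e i - \sum_l scal (B i 0 l) * e' l).
    under [X in _ = _ + X]eq_bigr do rewrite mulrBr.
    rewrite sumrB addrA subrK; congr (_ - _).
    under [RHS]eq_bigr do rewrite mulr_sumr.
    rewrite exchange_big; apply: eq_bigr => l _ /=.
    rewrite !mxE !rmorph_sum mulr_suml /=; apply: eq_bigr => i _.
    by rewrite !mxE !rmorphM mulrA.
  by apply: WD => //; apply: Wsum => i; apply: WZ.
apply: Hc; rewrite (bigD1 j) //= big1 ?addr0 => [|l ne].
  by rewrite !mxE eqxx !rmorph1 mul1r subrr.
by rewrite !mxE eq_sym (negPf ne) !rmorph0 mul0r.
Qed.

End QuotientDimension.

Section LocalTjurina.
Variable K : numClosedFieldType.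
Local Notation S := {mpoly K[3]}.
Local Notation A := {mpoly K[2]}.
Local Notation Frac := {fraction A}.
Local Notation "x %:F" := (@tofrac A x) : ring_scope.

Section LocalRing.
Variable q : 'I_2 -> K.

Lemma local_ring_poly (a : A) : local_ring q a%:F.
Proof. by exists a, 1; rewrite meval1 oner_neq0 tofrac1 divr1. Qed.

Lemma meval_neq0 (b : A) : b.@[q] != 0 -> b%:F != 0.
Proof. by apply: contraNneq => /eqP; rewrite tofrac_eq0 => /eqP->; rewrite meval0. Qed.

Lemma local_ringD x y : local_ring q x -> local_ring q y -> local_ring q (x + y).
Proof.
move=> [a [b [b0 ->]]] [a' [b' [b0' ->]]].
exists (a * b' + a' * b), (b * b'); rewrite mevalM mulf_neq0 //; split => //.
by rewrite addf_div ?meval_neq0 // tofracD !tofracM.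
Qed.

Lemma local_ringM x y : local_ring q x -> local_ring q y -> local_ring q (x * y).
Proof.
move=> [a [b [b0 ->]]] [a' [b' [b0' ->]]].
exists (a * a'), (b * b'); rewrite mevalM mulf_neq0 //; split => //.
by rewrite mulf_div !tofracM.
Qed.

End LocalRing.

Variables (i : 'I_3) (d : nat) (f : S).
Hypotheses (d_gt0 : (0 < d)%N) (hf : f \is d.-homog).
Local Notation deh := (@dehomog K i).

(** In the chart X_i = 1 Euler's identity reads d f = f_i + sum_k X_k f_k. It expresses f by the
    three partial derivatives, and f_i by f and the two partial derivatives of the chart. *)
Lemma tjurina_idealE q x : tjurina_ideal q (deh f) x <->
  exists b : 'I_3 -> Frac, (forall j, local_ring q (b j)) /\
    x = \sum_j b j * (deh f^`M(j))%:F.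
Proof.
have euler : d%:R * (deh f)%:F = \sum_j (deh 'X_j)%:F * (deh f^`M(j))%:F.
  rewrite -(tofrac1 A) -tofracMn -tofracM mulr_natl.
  transitivity ((deh (d%:R *: f))%:F : Frac).
    by rewrite scaler_nat (raddfMn deh).
  by rewrite -(euler_identity hf) (raddf_sum deh) (raddf_sum (@tofrac A)); apply: eq_bigr => j _; rewrite /= !rmorphM.
have d0 : d%:R != 0 :> Frac.
  rewrite -(tofrac1 A) -tofracMn tofrac_eq0 -mpolyC_nat mpolyC_eq0.
  by rewrite pnatr_eq0 -lt0n.
split=> [[a [b [Oa Ob ->]]]|[b [Ob ->]]].
  exists (fun j => a * d%:R^-1 * (deh 'X_j)%:F + if unlift i j is Some k then b k else 0).
  split=> [j|].
    apply: local_ringD; last first.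
      by case: unlift => [k|]; [exact: Ob|rewrite -tofrac0; apply: local_ring_poly].
    apply: local_ringM; last exact: local_ring_poly.
    apply: local_ringM => //; exists 1, d%:R; rewrite -mpolyC_nat mevalC pnatr_eq0 -lt0n.
    by split => //; rewrite tofrac1 mul1r mpolyC_nat tofracMn tofrac1.
  under [RHS]eq_bigr do rewrite mulrDl.
  rewrite big_split /=; congr (_ + _).
    rewrite -[(deh f)%:F](mulKf d0) euler !mulr_sumr; apply: eq_bigr => j _.
    by rewrite !mulrA.
  rewrite (bigD1_ord i) //= unlift_none mul0r add0r; apply: eq_bigr => k _.
  by rewrite liftK dehomog_deriv.
exists (b i * d%:R), (fun k => b (lift i k) - b i * ('X_k)%:F); split.
- apply: local_ringM => //; rewrite -(tofrac1 A) -tofracMn; exact: local_ring_poly.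
- move=> k; apply: local_ringD => //; rewrite -mulrN -tofracN.
  by apply: local_ringM => //; apply: local_ring_poly.
rewrite -mulrA euler !(bigD1_ord i) //= dehomog_base tofrac1 mul1r mulrDr -addrA.
congr (_ + _); rewrite mulr_sumr -big_split /=; apply: eq_bigr => k _.
by rewrite dehomog_deriv dehomog_lift; ring.
Qed.

Variable p : 'rV[K]_3.
Hypothesis pi0 : p 0 i != 0.
Let q := fun k => p 0 (lift i k) / p 0 i.

Lemma meval_dehomog_neq0 e a : a \is e.-homog ->
  ((deh a).@[q] != 0) = (a.@[p 0] != 0).
Proof.
by move=> ha; rewrite (meval_dehomog pi0 ha) mulf_eq0 expf_eq0 (negPf pi0) andbF.
Qed.

(** Clearing denominators turns a local relation into B a = sum_j C_j f_j in the chart; B and the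
    C_j lift to forms of matching degrees, and by [dehomog_eq0] the relation holds for the lifts. *)
Lemma tjurina_ideal_local k a : a \is (k + d.-1).-homog ->
  tjurina_ideal q (deh f) (deh a)%:F <-> local_ideal (jacobian f) p a.
Proof.
move=> ha; split=> [/tjurina_idealE[b [Ob E]]|[e [b [hb bp [c E]]]]]; last first.
  apply/tjurina_idealE; exists (fun j => (deh (c j))%:F / (deh b)%:F); split.
    by move=> j; exists (deh (c j)), (deh b); rewrite (meval_dehomog_neq0 hb).
  have b0 : (deh b)%:F != 0 by apply: (@meval_neq0 q); rewrite (meval_dehomog_neq0 hb).
  apply: (mulfI b0); rewrite -tofracM -(rmorphM deh) E (raddf_sum deh) (raddf_sum (@tofrac A)) mulr_sumr /=.
  by apply: eq_bigr => j _; rewrite (rmorphM deh) tofracM mulrA mulrCA divff // mulr1.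
have /choice[n Hn] : forall j, exists a : A * A, a.2.@[q] != 0 /\ b j = a.1%:F / a.2%:F.
  by move=> j; have [u [v [v0 ->]]] := Ob j; exists (u, v).
pose B := \prod_j (n j).2; pose C j := (n j).1 * \prod_(l | l != j) (n l).2.
have Bq : B.@[q] != 0.
  by rewrite rmorph_prod; apply/prodf_neq0 => j _; case: (Hn j).
have EBC : B * deh a = \sum_j C j * deh f^`M(j).
  apply/eqP; rewrite -(tofrac_eq); apply/eqP; rewrite tofracM E mulr_sumr (raddf_sum (@tofrac A)) /=.
  apply: eq_bigr => j _; rewrite !tofracM mulrA; congr (_ * _).
  have [nj ->] := Hn j; rewrite /B (bigD1 j) //= tofracM.
  rewrite mulrCA; congr (_ * _).
  by rewrite mulrAC divff ?mul1r // (@meval_neq0 q).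
have [eB HB] := homogenization i B.
have /choice[eC HC] := fun j => homogenization i (C j).
pose e := (eB + \sum_j eC j)%N.
have [b0 [hb0 Eb0]] := HB e (leq_addr _ _).
have /choice[c Hc] : forall j, exists c, c \is (e + k).-homog /\ deh c = C j.
  move=> j; apply: HC; rewrite /e (bigD1 j) //=; lia.
exists e, b0; split => //; first by rewrite -(meval_dehomog_neq0 hb0) Eb0.
exists c; apply/eqP; rewrite -subr_eq0; apply/eqP.
apply: (@dehomog_eq0 _ i (e + (k + d.-1))%N).
  apply: rpredB; first exact: dhomogM.
  apply: rpred_sum => j _; rewrite addnA; apply: dhomogM; first by case: (Hc j).
  exact: mderiv_homog.
rewrite rmorphB rmorphM /= Eb0 EBC (raddf_sum deh) /=; apply/eqP; rewrite subr_eq0.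
by apply/eqP; apply: eq_bigr => j _; rewrite rmorphM /=; case: (Hc j) => _ ->.
Qed.

Lemma tjurina_ideal0 : tjurina_ideal q (deh f) 0.
Proof.
apply/tjurina_idealE; exists (fun=> 0); split=> [j|].
  by rewrite -tofrac0; apply: local_ring_poly.
by rewrite big1 // => j _; rewrite mul0r.
Qed.

Lemma tjurina_idealD x y : tjurina_ideal q (deh f) x -> tjurina_ideal q (deh f) y ->
  tjurina_ideal q (deh f) (x + y).
Proof.
move=> /tjurina_idealE[b [Ob ->]] /tjurina_idealE[b' [Ob' ->]]; apply/tjurina_idealE.
exists (fun j => b j + b' j); split=> [j|]; first exact: local_ringD.
by rewrite -big_split; apply: eq_bigr => j _; rewrite mulrDl.
Qed.

Lemma tjurina_idealM x y : local_ring q x -> tjurina_ideal q (deh f) y ->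
  tjurina_ideal q (deh f) (x * y).
Proof.
move=> Ox /tjurina_idealE[b [Ob ->]]; apply/tjurina_idealE.
exists (fun j => x * b j); split=> [j|]; first exact: local_ringM.
by rewrite mulr_sumr; apply: eq_bigr => j _; rewrite mulrA.
Qed.

(** For x = a / b, lift a and b to forms a', b' of one degree. As b' acts surjectively modulo I_p,
    a' X_i^k is congruent to b' u for a form u of degree k, and u approximates x in the chart. *)
Lemma tjurina_ideal_approx n k0 k x :
  (forall k, (k0 <= k)%N -> hilbert (local_ideal (jacobian f) p) k = n) ->
  (k0 <= k)%N -> (d <= k)%N -> local_ring q x ->
  exists u : dhomog 3 K k, tjurina_ideal q (deh f) (x - (deh (val u))%:F).
Proof.
move=> Hn le led [a [b [bq ->]]].
have [ea Ha] := homogenization i a; have [eb Hb] := homogenization i b.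
have [a' [ha Ea]] := Ha (ea + eb)%N (leq_addr _ _).
have [b' [hb Eb]] := Hb (ea + eb)%N (leq_addl _ _).
set e := (ea + eb)%N in ha hb.
have HJ := jacobian_ideal f.
have b'p : b'.@[p 0] != 0 by rewrite -(meval_dehomog_neq0 hb) Eb.
have [h hE] := mul_hom k hb.
have Hs := local_mul_surj HJ Hn hb b'p le hE.
have haX : a' * 'X_i ^+ k \is (e + k).-homog.
  by apply: dhomogM => //; have := dhomogMn k (dhomog_U K i); rewrite mul1n.
have : DHomog haX \in (limg h + piece (local_ideal (jacobian f) p) (e + k))%VS.
  by rewrite Hs memvf.
move=> /memv_addP[_ /memv_imgP[u _ ->] [y yQ /(congr1 val)]] /=.
rewrite hE => E; exists u.
have {yQ} Ty : tjurina_ideal q (deh f) (deh (val y))%:F.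
  apply/(@tjurina_ideal_local (e + k - d.-1)).
    by rewrite subnK ?dhomog_is_dhomog // (leq_trans (leq_pred _)) // (leq_trans led) // leq_addl.
  by apply/(mem_piece _ (local_ideal_ideal p HJ)).
have b0 := meval_neq0 bq.
have Ey : a%:F = b%:F * (deh (val u))%:F + (deh (val y))%:F.
  rewrite -Ea -Eb -!tofracM -tofracD -rmorphM -rmorphD -E rmorphM rmorphXn /=.
  by rewrite dehomog_base expr1n mulr1.
have -> : a%:F / b%:F - (deh (val u))%:F = b%:F^-1 * (deh (val y))%:F.
  by apply: (mulfI b0); rewrite mulrBr mulrCA divff // mulr1 Ey addrC addKr mulVKf.
apply: tjurina_idealM => //; exists 1, b; split => //.
by rewrite tofrac1 mul1r.
Qed.

(** A basis of a complement of (I_p)_k in S_k, restricted to the chart, is a basis of the local ring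
    modulo the Tjurina ideal. *)
Lemma has_qdim_hilbert n k0 :
  (forall k, (k0 <= k)%N -> hilbert (local_ideal (jacobian f) p) k = n) ->
  has_qdim (local_ring q) (tjurina_ideal q (deh f)) n.
Proof.
move=> Hn; pose k := (k0 + d)%N.
have HQ := local_ideal_ideal p (jacobian_ideal f).
set U := piece (local_ideal (jacobian f) p) k.
have Un : \dim (U^C) = n by rewrite dimv_compl -(Hn k) // leq_addr.
subst n; pose b := vbasis (U^C)%VS.
have TU (u : dhomog 3 K k) : tjurina_ideal q (deh f) (deh (val u))%:F <-> u \in U.
  have hu : val u \is (k - d.-1 + d.-1).-homog.
    by rewrite subnK ?dhomog_is_dhomog // (leq_trans (leq_pred _)) // leq_addl.
  split=> [/(tjurina_ideal_local hu)|/(mem_piece _ HQ) H]; first by move/(mem_piece _ HQ).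
  exact/(tjurina_ideal_local hu).
have dehsum (c : 'rV[K]_(\dim (U^C))) :
  (deh (val (\sum_j c 0 j *: b`_j)))%:F =
  \sum_j (((c 0 j)%:MP : A)%:F * (deh (val b`_j))%:F : Frac).
  rewrite linear_sum (raddf_sum deh) (raddf_sum (@tofrac A)) /=; apply: eq_bigr => j _.
  by rewrite /= linearZ /= -mul_mpolyC tofracM.
exists (fun j => (deh (val b`_j))%:F); split=> [j|x Ox]; first exact: local_ring_poly.
have [u Tu] := tjurina_ideal_approx Hn (leq_addr _ _) (leq_addl _ _) Ox.
have : u \in (U + U^C)%VS by rewrite addv_complf memvf.
move=> /memv_addP[v Uv [w Cw Eu]].
have Ew := coord_vbasis Cw.
exists (\row_j coord b j w); split.
  rewrite -dehsum.
  have -> : \sum_j (\row_j coord b j w) 0 j *: b`_j = w.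
    by rewrite [RHS]Ew; apply: eq_bigr => j _; rewrite mxE.
  have -> : x - (deh (val w))%:F = (x - (deh (val u))%:F) + (deh (val v))%:F.
    by rewrite Eu linearD !rmorphD /= opprD addrA [RHS]addrAC subrK.
  by apply: tjurina_idealD => //; apply/TU.
move=> c Tc.
pose c' := \row_j coord b j w - c.
have : \sum_j c' 0 j *: b`_j \in U.
  apply/TU; rewrite dehsum.
  have -> : \sum_j ((c' 0 j)%:MP : A)%:F * (deh (val b`_j))%:F =
      (x - \sum_j ((c 0 j)%:MP : A)%:F * (deh (val b`_j))%:F) +
      (- (1%:MP : A)%:F) * ((x - (deh (val u))%:F) + (deh (val v))%:F).
    have -> : (x - (deh (val u))%:F) + (deh (val v))%:F =
       x - \sum_j (((\row_j coord b j w) 0 j)%:MP : A)%:F * (deh (val b`_j))%:F.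
      rewrite -dehsum.
      have -> : \sum_j (\row_j coord b j w) 0 j *: b`_j = w.
        by rewrite [RHS]Ew; apply: eq_bigr => j _; rewrite mxE.
      by rewrite Eu linearD !rmorphD /= opprD addrA addrAC subrK.
    rewrite mpolyC1 tofrac1 mulN1r opprB addrC addrA subrK -sumrB.
    by apply: eq_bigr => j _; rewrite !mxE !rmorphB mulrBl.
  apply: tjurina_idealD => //; apply: tjurina_idealM.
    by rewrite -tofracN; apply: local_ring_poly.
  by apply: tjurina_idealD => //; apply/TU.
move=> inU; have : \sum_j c' 0 j *: b`_j \in (U :&: U^C)%VS.
  rewrite memv_cap inU rpred_sum // => j _; apply: rpredZ.
  by apply: vbasis_mem; rewrite mem_nth // size_tuple.
have /freeP free_b := basis_free (vbasisP (U^C)%VS).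
rewrite capv_compl memv0 => /eqP /free_b H.
apply/eqP; rewrite -subr_eq0; apply/eqP/rowP => j.
by have := H j; rewrite !mxE.
Qed.

Lemma local_tjurina_hilbert n k0 :
  (forall k, (k0 <= k)%N -> hilbert (local_ideal (jacobian f) p) k = n) ->
  local_tjurina q (deh f) = n.
Proof.
move=> /has_qdim_hilbert H; apply: xget_unique => // n' H'.
have WZ c x : tjurina_ideal q (deh f) x -> tjurina_ideal q (deh f) ((c%:MP : A)%:F * x).
  by apply: tjurina_idealM; apply: local_ring_poly.
apply/eqP; rewrite eqn_leq (has_qdim_le tjurina_ideal0 tjurina_idealD WZ H H').
by rewrite (has_qdim_le tjurina_ideal0 tjurina_idealD WZ H' H).
Qed.

End LocalTjurina.

Section TotalTjurina.
Variable K : numClosedFieldType.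
Local Notation S := {mpoly K[3]}.
Implicit Types f : S.

(** The base locus only sees the partial derivatives; Euler's identity with d nonzero adds the
    vanishing of f. *)
Lemma singular_base_locus d f p : (0 < d)%N -> f \is d.-homog ->
  base_locus (jacobian f) p <-> singular_points f p.
Proof.
move=> d0 hf; split=> [[pp Hp]|[pp _ Hp]]; last first.
  split=> // e _ _ [c ->]; rewrite raddf_sum big1 // => j _.
  by rewrite /= mevalM Hp mulr0.
split=> // [|j]; last first.
  exact: Hp (mderiv_homog j hf) (jacobian_deriv f j).
have : jacobian f (d%:R *: f).
  by rewrite -(euler_identity hf); exists (fun j => 'X_j).
move=> /(Hp d _ (rpredZ _ hf)); rewrite mevalZ => /eqP.
by rewrite mulf_eq0 pnatr_eq0 eqn0Ngt d0 => /eqP.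
Qed.

Theorem total_tjurina_hilbert d f c k0 : (0 < d)%N -> f \is d.-homog ->
  (forall k, (k0 <= k)%N -> (hilbert (jacobian f) k <= c)%N) ->
  exists k1, forall k, (k1 <= k)%N -> hilbert (jacobian f) k = total_tjurina f.
Proof.
move=> d0 hf Hc; have HJ := jacobian_ideal f.
have [c' [Hb Hc']] := hilbert_bounded HJ Hc.
have [ps [n [ups psP Hn [k1 Hk1]]]] :=
  hilbert_local_sum HJ (jacobian_homogeneous hf) Hb Hc'.
exists k1 => k /Hk1 ->; rewrite /total_tjurina.
have -> : singular_points f = [set` ps]%classic.
  apply/seteqP; split=> p /=; first by move/(singular_base_locus p d0 hf)/psP.
  by move/psP/(singular_base_locus p d0 hf).
rewrite -fsbig_seq // big_seq [RHS]big_seq; apply: eq_bigr => p pps.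
have [k2 Hk2] := Hn p pps; rewrite /tjurina; set i := odflt _ _.
symmetry; apply: (local_tjurina_hilbert d0 hf _ Hk2).
(* A normalized point has a coordinate equal to 1, so the default chart index is not taken. *)
rewrite /i; case: pickP => //= H.
have /psP[/plane_coord[j pj] _] := pps.
by have := H j; rewrite pj oner_eq0.
Qed.

End TotalTjurina.

(** * Syzygies and the determinant Delta *)

Section HomogeneousQuotients.
Variables (K : fieldType) (n : nat).
Implicit Types f g v : {mpoly K[n]}.

Lemma homog_quotient g f d N : f != 0 -> g != 0 -> f \is d.-homog ->
  g * f \is N.-homog -> (d <= N)%N /\ g \is (N - d).-homog.
Proof.
move=> f0 g0 hf hgf.
have H k : (k + d != N)%N -> pihomog mdeg k g = 0.
  move=> ne; apply: (mulIf f0); rewrite mul0r -(pihomogM _ _ hf).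
  by rewrite (pihomog_ne0 _ hgf) // eq_sym.
have Eg := pihomog_partitionE (leqnn (msize g)).
have [le|lt] := leqP d N; last first.
  case/eqP: g0; rewrite Eg big1 // => k _; apply: H.
  by rewrite gtn_eqF // (leq_trans lt) // leq_addl.
split=> //; rewrite Eg; apply: rpred_sum => k _.
have [E|/H ->] := eqVneq (k + d)%N N; last exact: dhomog0.
by rewrite -E addnK; apply: pihomogP.
Qed.

Lemma msize_homog f d : f \is d.-homog -> f != 0 -> msize f = d.+1.
Proof.
move=> hf f0; rewrite (mpolySpred mdeg f0); congr _.+1.
by apply/esym/(dhomog_uniq f0 hf)/(dhomog_msize hf).
Qed.

Lemma mpolyX_prime i : prime_elt ('X_i : {mpoly K[n]}).
Proof.
apply: mpoly_euclid; split.
- by rewrite -msize_poly_eq0 msizeX.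
- by rewrite mpoly_unitE msizeX mdeg1.
move=> a b E; rewrite !mpoly_unitE.
have a0 : a != 0 by apply: contraPneq E => ->; rewrite mul0r => /eqP; rewrite -msize_poly_eq0 msizeX.
have b0 : b != 0 by apply: contraPneq E => ->; rewrite mulr0 => /eqP; rewrite -msize_poly_eq0 msizeX.
have := msize_mul a0 b0; rewrite -E msizeX mdeg1.
move: a0 b0; rewrite -!msize_poly_eq0.
case: (msize a) => [|[|x]] // _; first by left.
by case: (msize b) => [|[|y]] // _; [right|rewrite !addSn !addnS].
Qed.

Lemma mpolyX_mul_eq i j f g : i != j -> 'X_i * f = 'X_j * g -> divides 'X_i g.
Proof.
move=> ne E; have [_ _ P] := mpolyX_prime i.
have [|[c Ec]|//] := P 'X_j g; first by exists f; rewrite -E mulrC.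
have := congr1 (meval (fun l => (l != i)%:R)) Ec.
rewrite mevalM !mevalXU eqxx mulr0 eq_sym ne => /eqP.
by rewrite oner_eq0.
Qed.

End HomogeneousQuotients.

(** * Koszul relations and the socle *)

Section Koszul.
Variable K : fieldType.
Local Notation S := {mpoly K[3]}.
Implicit Types (g h v : S).

Let i0 : 'I_3 := @Ordinal 3 0 isT.
Let i1 : 'I_3 := @Ordinal 3 1 isT.
Let i2 : 'I_3 := @Ordinal 3 2 isT.

Lemma sum3E (V : nmodType) (F : 'I_3 -> V) : \sum_j F j = F i0 + F i1 + F i2.
Proof.
rewrite !big_ord_recl big_ord0 addr0 addrA.
by congr (F _ + F _ + F _); apply: val_inj.
Qed.

(** X_2 is a nonzerodivisor modulo (X_0, X_1): the substitution sigma, which sets X_0 = X_1 = 0,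
    gives X_2 sigma(h) = 0, and h - sigma(h) always lies in (X_0, X_1). *)
Lemma regular_XYZ h k l : 'X_i2 * h = 'X_i1 * k - 'X_i0 * l ->
  exists u w, h = 'X_i0 * u + 'X_i1 * w.
Proof.
pose sigma : {lrmorphism S -> S} := comp_mpoly [tuple if j == i2 then 'X_i2 else (0 : S) | j < 3].
have sX j : sigma 'X_j = if j == i2 then 'X_i2 else 0.
  by rewrite /sigma /= comp_mpolyXU -tnth_nth tnth_mktuple.
have red g : exists u w, g = sigma g + 'X_i0 * u + 'X_i1 * w.
  elim/mpolyind: g => [|c m p _ _ [u [w E]]].
    by exists 0, 0; rewrite rmorph0 !mulr0 !addr0.
  suff [u' [w' E']] : exists u w, 'X_[m] = sigma 'X_[m] + 'X_i0 * u + 'X_i1 * w.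
    exists (c *: u' + u), (c *: w' + w).
    by rewrite {1}E {1}E' linearP /= -!mul_mpolyC; ring.
  have [N] := ubnP (mdeg m); elim: N m {E} => // N IH m /ltnSE-le.
  have [->|m0] := eqVneq m 0%MM.
    by exists 0, 0; rewrite mpolyX0 rmorph1 !mulr0 !addr0.
  have [j [m' Em]] := monomial_split m0.
  have [|u' [w' E']] := IH m'; first by move: le; rewrite Em mdegD mdeg1 add1n.
  rewrite Em mpolyXD rmorphM /= sX; move: j {Em}; apply: ord3P => /=.
  - by exists 'X_[m'], 0; ring.
  - by exists 0, 'X_[m']; ring.
  - by exists ('X_i2 * u'), ('X_i2 * w'); rewrite {1}E'; ring.
move=> E; have [u [w Eh]] := red h; exists u, w; rewrite [LHS]Eh.
suff -> : sigma h = 0 by rewrite add0r.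
have := congr1 sigma E; rewrite rmorphB !rmorphM /= !sX /= !mul0r subrr.
by move/eqP; rewrite mulf_eq0 -msize_poly_eq0 msizeX => /eqP.
Qed.

(* The socle of S / (g, h) vanishes, by comparing the syzygies of the Koszul
   complexes of (g, h) and of (X, Y, Z). *)
Lemma complete_intersection_socle g h v : g != 0 -> h != 0 ->
  (forall e, mdvd e g -> mdvd e h -> (msize e <= 1)%N) ->
  (forall i, exists p q, 'X_i * v = p * g + q * h) ->
  exists p q, v = p * g + q * h.
Proof.
move=> g0 h0 cop H.
have [p0 [q0 E0]] := H i0; have [p1 [q1 E1]] := H i1; have [p2 [q2 E2]] := H i2.
have syz a b pa qa pb qb : 'X_a * v = pa * g + qa * h -> 'X_b * v = pb * g + qb * h ->
    exists c, 'X_b * pa - 'X_a * pb = c * h /\ 'X_b * qa - 'X_a * qb = - c * g.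
  move=> Ea Eb.
  have Eab : ('X_b * pa - 'X_a * pb) * g = - ('X_b * qa - 'X_a * qb) * h.
    have : 'X_b * ('X_a * v) = 'X_a * ('X_b * v) by ring.
    rewrite Ea Eb => Eab; apply/eqP; rewrite -subr_eq0; apply/eqP.
    have -> : ('X_b * pa - 'X_a * pb) * g - - ('X_b * qa - 'X_a * qb) * h =
      'X_b * (pa * g + qa * h) - 'X_a * (pb * g + qb * h) by ring.
    by rewrite Eab subrr.
  have [|c Ec] := @mpoly_coprime_mdvd K 3 h g _ _ h0 _ Eab.
    by move=> e eh eg; apply: cop.
  exists c; split=> //; apply: (mulIf h0).
  by apply: oppr_inj; rewrite -mulNr -Eab Ec; ring.
have [c2 [P2 Q2]] := syz _ _ _ _ _ _ E0 E1.
have [c1 [P1 Q1]] := syz _ _ _ _ _ _ E0 E2.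
have [c0 [P0 Q0]] := syz _ _ _ _ _ _ E1 E2.
(* The Koszul coefficients c0, c1, c2 of the three comparisons satisfy X_2 c2 = X_1 c1 - X_0 c0. *)
have [|u [w Ec]] := @regular_XYZ c2 c1 c0.
  apply: (mulIf h0).
  have -> : ('X_i1 * c1 - 'X_i0 * c0) * h = 'X_i1 * (c1 * h) - 'X_i0 * (c0 * h) by ring.
  by rewrite -P1 -P0 -mulrA -P2; ring.
(* The corrected coefficients p0 - w h and q0 + w g still represent X_0 v, and now both are
   divisible by X_0. *)
have [|p Ep] := @mpolyX_mul_eq K 3 i0 i1 (p1 + u * h) (p0 - w * h) isT.
  apply/eqP; rewrite -subr_eq0; apply/eqP.
  have -> : 'X_i0 * (p1 + u * h) - 'X_i1 * (p0 - w * h) =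
     ('X_i0 * u + 'X_i1 * w) * h - ('X_i1 * p0 - 'X_i0 * p1) by ring.
  by rewrite P2 Ec subrr.
have [|q Eq] := @mpolyX_mul_eq K 3 i0 i1 (q1 - u * g) (q0 + w * g) isT.
  apply/eqP; rewrite -subr_eq0; apply/eqP.
  have -> : 'X_i0 * (q1 - u * g) - 'X_i1 * (q0 + w * g) =
     - ('X_i0 * u + 'X_i1 * w) * g - ('X_i1 * q0 - 'X_i0 * q1) by ring.
  by rewrite Q2 Ec subrr.
exists p, q; have X0 : ('X_i0 : S) != 0 by rewrite -msize_poly_eq0 msizeX.
apply: (mulfI X0); rewrite E0.
have -> : p0 * g + q0 * h = (p0 - w * h) * g + (q0 + w * g) * h by ring.
by rewrite Ep Eq; ring.
Qed.

End Koszul.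

(** * Identities for Delta *)

Section DeltaIdentities.
Variable K : numFieldType.
Local Notation S := {mpoly K[3]}.
Implicit Types (r s t : 'rV[S]_3).

Let i0 : 'I_3 := @Ordinal 3 0 isT.
Let i1 : 'I_3 := @Ordinal 3 1 isT.
Let i2 : 'I_3 := @Ordinal 3 2 isT.

Definition cross r s : 'I_3 -> S :=
  fun j => nth 0 [:: r 0 i1 * s 0 i2 - r 0 i2 * s 0 i1;
                     r 0 i2 * s 0 i0 - r 0 i0 * s 0 i2;
                     r 0 i0 * s 0 i1 - r 0 i1 * s 0 i0] j.

Lemma det3E (R : comNzRingType) (A : 'M[R]_3) :
  \det A = A i0 i0 * (A i1 i1 * A i2 i2 - A i1 i2 * A i2 i1)
         - A i0 i1 * (A i1 i0 * A i2 i2 - A i1 i2 * A i2 i0)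
         + A i0 i2 * (A i1 i0 * A i2 i1 - A i1 i1 * A i2 i0).
Proof.
(* Indices pass through natural numbers, so that [ring] identifies entries whose ordinals differ
   only in their proofs. *)
pose F a b := A (inord a) (inord b).
have EA i j : A i j = F i j by rewrite /F !inord_val.
rewrite (expand_det_row _ ord0) !big_ord_recl big_ord0.
rewrite /cofactor !(expand_det_row _ ord0) !big_ord_recl !big_ord0.
rewrite /cofactor !det_mx11 !mxE !EA /= /bump /=; ring.
Qed.

Lemma DeltaE r s : Delta r s = \sum_j 'X_j * cross r s j.
Proof. rewrite /Delta det3E !mxE /= ?mxE sum3E /cross /=; ring. Qed.

Variables (f : S) (d : nat).
Hypotheses (f0 : f != 0) (d_gt0 : (0 < d)%N) (hf : f \is d.-homog).

(** Write c for the vector product of r and s. Both rows are orthogonal to the gradient of f, so c_i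
    f_j = c_j f_i; multiplying by X_i and summing over i gives the identity by Euler. *)
Lemma Delta_deriv r s j : AR f r -> AR f s ->
  Delta r s * f^`M(j) = d%:R *: f * cross r s j.
Proof.
rewrite /AR !sum3E => Er Es; rewrite DeltaE -(euler_identity hf) !sum3E.
apply/eqP; rewrite -subr_eq0; apply/eqP; move: j.
set x := 'X_i0; set y := 'X_i1; set z := 'X_i2.
set fx := f^`M(i0) in Er Es *; set fy := f^`M(i1) in Er Es *; set fz := f^`M(i2) in Er Es *.
set ra := r 0 i0 in Er *; set rb := r 0 i1 in Er *; set rc := r 0 i2 in Er *.
set sa := s 0 i0 in Es *; set sb := s 0 i1 in Es *; set sc := s 0 i2 in Es *.
apply: ord3P; rewrite /cross /= -/ra -/rb -/rc -/sa -/sb -/sc -?/fx -?/fy -?/fz.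
- transitivity (y * (rc * (sa * fx + sb * fy + sc * fz) - sc * (ra * fx + rb * fy + rc * fz))
    - z * (rb * (sa * fx + sb * fy + sc * fz) - sb * (ra * fx + rb * fy + rc * fz))).
    by ring.
  by rewrite Er Es !mulr0 subrr !mulr0 subrr.
- transitivity (z * (ra * (sa * fx + sb * fy + sc * fz) - sa * (ra * fx + rb * fy + rc * fz))
    - x * (rc * (sa * fx + sb * fy + sc * fz) - sc * (ra * fx + rb * fy + rc * fz))).
    by ring.
  by rewrite Er Es !mulr0 subrr !mulr0 subrr.
- transitivity (x * (rb * (sa * fx + sb * fy + sc * fz) - sb * (ra * fx + rb * fy + rc * fz))
    - y * (ra * (sa * fx + sb * fy + sc * fz) - sa * (ra * fx + rb * fy + rc * fz))).
    by ring.
  by rewrite Er Es !mulr0 subrr !mulr0 subrr.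
Qed.

Lemma Delta_dvd r s : squarefree f -> AR f r -> AR f s -> mdvd f (Delta r s).
Proof.
move=> sqf Hr Hs; apply: squarefree_dvd => // j.
by exists (d%:R *: cross r s j); rewrite (Delta_deriv j Hr Hs) -!mul_mpolyC; ring.
Qed.

Lemma vquotE r s : squarefree f -> AR f r -> AR f s -> Delta r s = vquot f r s * f.
Proof.
by move=> sqf Hr Hs; have [g E] := Delta_dvd sqf Hr Hs; apply: (@xgetPex _ 0 [set g | _ = g * f]%classic); exists g.
Qed.

Lemma Delta_eq0 r s : AR f r -> AR f s -> Delta r s = 0 ->
  forall i j, s 0 i * r 0 j = s 0 j * r 0 i.
Proof.
move=> Hr Hs D0.
have C0 j : cross r s j = 0.
  have := Delta_deriv j Hr Hs; rewrite D0 mul0r => /esym /eqP.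
  rewrite mulf_eq0 -mul_mpolyC mulf_eq0 (negPf f0) mpolyC_eq0 pnatr_eq0 eqn0Ngt d_gt0 /=.
  by move/eqP.
have := C0 i2; have := C0 i1; have := C0 i0; rewrite /cross /=.
move=> /eqP; rewrite subr_eq0 => /eqP E0 /eqP; rewrite subr_eq0 => /eqP E1.
move=> /eqP; rewrite subr_eq0 => /eqP E2.
apply: ord3P; apply: ord3P => //; rewrite ![s _ _ * _]mulrC //.
Qed.

Lemma DeltaD r s t : Delta r (s + t) = Delta r s + Delta r t.
Proof. by rewrite !DeltaE !sum3E /cross /= !mxE; ring. Qed.

Lemma DeltaZ r (a : S) s : Delta r (a *: s) = a * Delta r s.
Proof. by rewrite !DeltaE !sum3E /cross /= !mxE; ring. Qed.

Lemma Delta_self r : Delta r r = 0.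
Proof. by rewrite DeltaE sum3E /cross /=; ring. Qed.

Lemma Delta_homog r s k l : vhomog k r -> vhomog l s ->
  Delta r s \is (k + l).+1.-homog.
Proof.
move=> hr hs; rewrite DeltaE; apply: rpred_sum => j _; rewrite -(add1n (k + l)); apply: dhomogM.
  by rewrite dhomogX /= mdeg1.
by move: j; apply: ord3P => /=; apply: rpredB; apply: dhomogM.
Qed.

Lemma ARD s t : AR f s -> AR f t -> AR f (s + t).
Proof.
rewrite /AR => Es Et; under eq_bigr do rewrite mxE mulrDl.
by rewrite big_split /= Es Et addr0.
Qed.

Lemma ARZ (a : S) s : AR f s -> AR f (a *: s).
Proof.
rewrite /AR => Es; under eq_bigr do rewrite mxE -mulrA.
by rewrite -mulr_sumr Es mulr0.
Qed.

Lemma AR_cancel (a : S) s : a != 0 -> AR f (a *: s) -> AR f s.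
Proof.
rewrite /AR => a0; under eq_bigr do rewrite mxE -mulrA.
by rewrite -mulr_sumr => /eqP; rewrite mulf_eq0 (negPf a0) => /eqP.
Qed.

(** No prime divides all entries of r, so every prime of a divides b and cancels. *)
Lemma proportional (r s : 'rV[S]_3) a b : a != 0 ->
  (forall p, prime_elt p -> exists j, ~ divides p (r 0 j)) ->
  a *: s = b *: r -> exists h, s = h *: r.
Proof.
move=> + prim; move=> a0; move: a a0 b.
apply: (prime_ind (@mpoly_euclid K 3) (@msize_factor K 3)) => [u uU b E|p c pp c0 IH b E].
  by exists (b / u); rewrite mulrC -scalerA -E scalerA mulVr // scale1r.
have [j nj] := prim p pp; have [p0 _ pP] := pp.
have [|[b' Eb]|//] := pP b (r 0 j).
  by exists (c * s 0 j); have := congr1 (fun m : 'rV[S]_3 => m 0 j) E; rewrite !mxE => <-; ring.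
apply: (IH b'); apply/rowP => l; apply: (mulfI p0).
have := congr1 (fun m : 'rV[S]_3 => m 0 l) E; rewrite !mxE Eb => El.
have -> : p * (c * s 0 l) = c * p * s 0 l by ring.
by rewrite El; ring.
Qed.

End DeltaIdentities.

Lemma dhomogM_eq n (R : comNzRingType) (p q : {mpoly R[n]}) k l m :
  p \is k.-homog -> q \is l.-homog -> (k + l = m)%N -> p * q \is m.-homog.
Proof. by move=> hp hq <-; apply: dhomogM. Qed.

(** Rank-nullity for (a, b) -> a D2 + b D3 in one degree, whose kernel consists of the Koszul
    relations (h g3, - h g2). D2 and D3 will be f g2 and f g3, so that P can be compared with the
    image of Delta(r1, .). *)
Lemma pair_image (K : numClosedFieldType) (D2 D3 g2 g3 : {mpoly K[3]})
    (n2 n3 l2 l3 k2 k3 c N : nat) :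
  D2 \is n2.-homog -> D3 \is n3.-homog -> g2 \is l2.-homog -> g3 \is l3.-homog ->
  (k2 + n2 = N)%N -> (k3 + n3 = N)%N -> (c + l3 = k2)%N -> (c + l2 = k3)%N ->
  g3 != 0 -> g3 * D2 = g2 * D3 ->
  (forall a b, a * D2 + b * D3 = 0 -> exists h, a = h * g3 /\ b = - (h * g2)) ->
  exists P : {vspace dhomog 3 K N},
    (forall u, u \in P <-> exists a b, [/\ a \is k2.-homog, b \is k3.-homog &
         val u = a * D2 + b * D3]) /\
    (\dim P + \dim {:dhomog 3 K c} = \dim {:dhomog 3 K k2} + \dim {:dhomog 3 K k3})%N.
Proof.
move=> hD2 hD3 hg2 hg3 N2 N3 c2 c3 g30 comm syz.
have hval n (u : dhomog 3 K n) : val u \is n.-homog := dhomog_is_dhomog u.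
pose T := (dhomog 3 K k2 * dhomog 3 K k3)%type.
have [||psi psiE] := @dhomog_hom K T N (fun u => val u.1 * D2 + val u.2 * D3).
- by move=> e u v; rewrite /= !mulrDl -!scalerAl scalerDr addrACA.
- move=> u; apply: rpredD; first exact: dhomogM_eq (hval _ u.1) hD2 N2.
  exact: dhomogM_eq (hval _ u.2) hD3 N3.
have [eta etaE] : exists eta : 'Hom(dhomog 3 K c, T),
    forall h, val (eta h).1 = val h * g3 /\ val (eta h).2 = - (val h * g2).
  have heta1 (h : dhomog 3 K c) : val h * g3 \is k2.-homog.
    exact: dhomogM_eq (hval _ h) hg3 c2.
  have heta2 (h : dhomog 3 K c) : - (val h * g2) \is k3.-homog.
    by rewrite rpredN; apply: dhomogM_eq (hval _ h) hg2 c3.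
  have [|eta etaE] := @linear_hom _ (dhomog 3 K c) T
     (fun h => (DHomog (heta1 h), DHomog (heta2 h))).
    move=> e u v; congr pair; apply: val_inj => /=.
      by rewrite mulrDl -scalerAl.
    by rewrite mulrDl -scalerAl opprD scalerN.
  by exists eta => h; rewrite etaE.
have etaI : (lker eta == 0)%VS.
  rewrite -subv0; apply/subvP => h; rewrite memv_ker memv0 => /eqP eh.
  apply/eqP/val_inj/(mulIf g30); have [<- _] := etaE h.
  by rewrite eh /= mul0r.
have imeta : lker psi = limg eta.
  apply/vspaceP => u; apply/idP/idP => [|/memv_imgP[h _ ->]]; last first.
    rewrite memv_ker; apply/eqP/val_inj; rewrite psiE; have [-> ->] := etaE h.
    by rewrite mulNr -!mulrA comm subrr.
  rewrite memv_ker => /eqP/(congr1 val); rewrite psiE => /syz[h [Eh1 Eh2]].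
  have hh := pihomogP mdeg c h.
  apply/memv_imgP; exists (DHomog hh); rewrite ?memvf //.
  have [H1 H2] := etaE (DHomog hh).
  have HH1 : u.1 = (eta (DHomog hh)).1.
    apply: val_inj; rewrite H1 /= -(pihomogM _ _ hg3) c2.
    by rewrite -Eh1 pihomog_dE.
  have HH2 : u.2 = (eta (DHomog hh)).2.
    apply: val_inj; rewrite H2 /= -(pihomogM _ _ hg2) c3.
    by rewrite -raddfN /= -Eh2 pihomog_dE.
  by rewrite [LHS]surjective_pairing HH1 HH2 -surjective_pairing.
exists (limg psi); split=> [u|].
  split=> [/memv_imgP[s _ ->]|[a [b [ha hb E]]]].
    by exists (val s.1), (val s.2); rewrite psiE.
  apply/memv_imgP; exists (DHomog ha, DHomog hb); rewrite ?memvf //.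
  by apply: val_inj; rewrite psiE.
have := limg_ker_dim psi fullv; rewrite capfv imeta (limg_dim_eq (f := eta)); last by
  rewrite (eqP etaI) capv0.
have -> : \dim {:T} = (\dim {:dhomog 3 K k2} + \dim {:dhomog 3 K k3})%N.
  by rewrite !dimvf.
by rewrite addnC.
Qed.

(** * Dimension counts in a fixed degree *)

Section Counting.
Variable K : numClosedFieldType.
Local Notation S := {mpoly K[3]}.
Variables (f : S) (d : nat) (r1 r2 r3 : 'rV[S]_3) (d1 d2 d3 : nat).
Hypotheses (d_gt0 : (0 < d)%N) (hf : f \is d.-homog) (sqf : squarefree f).
Hypotheses (AR1 : AR f r1) (AR2 : AR f r2) (AR3 : AR f r3).
Hypotheses (h1 : vhomog d1 r1) (h2 : vhomog d2 r2) (h3 : vhomog d3 r3).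
Hypothesis r1_neq0 : r1 != 0.
(** [msize] is the degree plus one: a nonzero syzygy, homogeneous or not, has an entry of degree at
    least d1. *)
Hypothesis r1_min : forall s, AR f s -> s != 0 -> exists i, (d1 < msize (s 0%R i))%N.
Variables g2 g3 : S.
Hypotheses (E2 : Delta r1 r2 = g2 * f) (E3 : Delta r1 r3 = g3 * f).
Hypothesis ci : complete_intersection2 g2 g3.

Let f0 : f != 0.
Proof. by case: sqf. Qed.

Lemma row_neq0 (s : 'rV[S]_3) : s != 0 -> exists j, s 0 j != 0.
Proof.
move=> s0; apply: contrapT => /forallNP H; case/eqP: s0; apply/rowP => j.
by rewrite mxE; apply/eqP/negPn/negP/H.
Qed.

(** Vanishing of Delta makes s proportional to r1. The entries of r1 have no common prime p, since
    r1 / p would be a nonzero syzygy of smaller degree. *)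
Lemma syzygy_kernel s : AR f s -> Delta r1 s = 0 -> exists h, s = h *: r1.
Proof.
move=> Hs D0; have [j rj] := row_neq0 r1_neq0.
apply: (@proportional _ r1 s (r1 0 j) (s 0 j)) => //; last first.
  apply/rowP => i; rewrite !mxE mulrC.
  exact: (Delta_eq0 f0 d_gt0 hf AR1 Hs D0).
move=> p [p0 pU _]; apply: contrapT => /forallNP H.
have /choice[u Hu] : forall i, exists c, r1 0 i = c * p by move=> i; apply: contrapT => /H.
have Er : r1 = p *: \row_i u i by apply/rowP => i; rewrite !mxE Hu mulrC.
have [||i lt] := r1_min (s := \row_i u i).
- by apply: (AR_cancel p0); rewrite -Er.
- by apply: contraNneq r1_neq0 => u0; rewrite Er u0 scaler0.
rewrite mxE in lt; have ui : u i != 0 by rewrite -msize_poly_eq0; case: (msize _) lt.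
have : r1 0 i != 0 by rewrite Hu mulf_neq0.
move=> /(msize_homog (h1 i)); rewrite Hu msize_mul //.
move: pU; rewrite mpoly_unitE; move: p0; rewrite -msize_poly_eq0.
case: (msize p) => [|[|a]] //; case: (msize (u i)) lt => // b lt _ _.
lia.
Qed.

(** If one of them is zero, the other is a common factor, hence constant. A nonzero constant
    generates the unit ideal, and if both are zero then X_0 is a common factor. *)
Lemma ci_neq0 : g2 != 0 /\ g3 != 0.
Proof.
have [cop nun] := ci.
have H (g h : S) : (forall e, mdvd e g -> mdvd e h -> (msize e <= 1)%N) ->
    ~ (exists a b : S, 1 = a * g + b * h) -> h != 0.
  move=> cop' nun'; apply/eqP => h0.
  have le1 : (msize g <= 1)%N.
    by apply: cop'; [exists 1; rewrite mul1r|exists 0; rewrite mul0r].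
  have [g0|g0] := eqVneq g 0.
    have : (msize ('X_ord0 : S) <= 1)%N.
      by apply: cop'; exists 0; rewrite mul0r.
    by rewrite msizeX mdeg1.
  apply: nun'; exists g^-1, 0; rewrite mul0r addr0 mulVr //.
  by rewrite mpoly_unitE eqn_leq le1 lt0n msize_poly_eq0.
split; last exact: H cop nun.
apply: (H g3 g2); first by move=> e e3 e2; apply: cop.
by move=> [a [b E]]; apply: nun; exists b, a; rewrite addrC.
Qed.

(** A nonunit g has positive degree; hence d is at most d1 + k, and the truncated subtraction in the
    degree of g is exact. *)
Lemma quotient_degree s k g : vhomog k s -> Delta r1 s = g * f -> g != 0 ->
  g \isn't a GRing.unit -> (d <= d1 + k)%N /\ g \is ((d1 + k).+1 - d).-homog.
Proof.
move=> hs E g0 gU; have hD := Delta_homog h1 hs; rewrite E in hD.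
have [le hg] := homog_quotient f0 g0 hf hD; split=> //.
rewrite -ltnS ltn_neqAle le andbT; apply: contra gU => /eqP Ed.
by rewrite mpoly_unitE (msize_homog hg g0) -Ed subnn.
Qed.

Lemma ci_nonunit : g2 \isn't a GRing.unit /\ g3 \isn't a GRing.unit.
Proof.
have [_ nun] := ci; split; apply/negP => U; apply: nun.
  by exists g2^-1, 0; rewrite mulVr // mul0r addr0.
by exists 0, g3^-1; rewrite mulVr // mul0r add0r.
Qed.

(** The integer z stands for n, so that truncated subtractions in n can be replaced by integer
    expressions. *)
Lemma dim_dhomog n (z : int) : n%:Z = z ->
  2 * (\dim {:dhomog 3 K n})%:Z = (z + 1) * (z + 2).
Proof.
move=> <-; have -> : \dim {:dhomog 3 K n} = 'C(n + 2, 2).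
  by rewrite dimvf /dim /= -(bin_sub (leq_addl n 2)) addnK.
have := mul_bin_diag (n + 2) 1; rewrite bin1.
move: 'C(_, _) => c; nia.
Qed.

Let hval n (u : dhomog 3 K n) : val u \is n.-homog := dhomog_is_dhomog u.

Section Syzygies.
Variable k : nat.
Local Notation V := {ffun 'I_3 -> dhomog 3 K k}.

(** Rows over S do not form a finite-dimensional K-space, so dimensions are counted in V, the
    triples of forms of degree k, and transported to rows. *)
Definition row_of (s : V) : 'rV[S]_3 := \row_j val (s j).

Lemma row_of_linear c u v : row_of (c *: u + v) = c%:MP *: row_of u + row_of v.
Proof. by apply/rowP => j; rewrite !mxE !ffunE linearP /= mul_mpolyC. Qed.

Lemma row_of_homog u : vhomog k (row_of u).
Proof. by move=> j; rewrite mxE. Qed.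

Lemma row_of_exists s : vhomog k s -> exists u, row_of u = s.
Proof.
move=> hs; exists [ffun j => DHomog (hs j)].
by apply/rowP => j; rewrite mxE ffunE.
Qed.

Lemma row_of_inj : injective row_of.
Proof.
move=> u v E; apply/ffunP => j; apply: val_inj.
by have := congr1 (fun s : 'rV[S]_3 => s 0 j) E; rewrite !mxE.
Qed.

Lemma syzygies_hilbert : exists Z : {vspace V},
  (forall u, u \in Z <-> AR f (row_of u)) /\
  (hilbert (jacobian f) (k + d.-1) + 3 * \dim {:dhomog 3 K k} =
   \dim {:dhomog 3 K (k + d.-1)} + \dim Z)%N.
Proof.
have [||phi phiE] := @dhomog_hom K V (k + d.-1) (fun u => \sum_j row_of u 0 j * f^`M(j)).
- move=> c u v; rewrite scaler_sumr -big_split; apply: eq_bigr => j _.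
  by rewrite /= row_of_linear !mxE -mul_mpolyC; ring.
- by move=> u; apply: rpred_sum => j _; apply: dhomogM; [exact: row_of_homog|exact: mderiv_homog].
exists (lker phi); split=> [u|].
  rewrite memv_ker; split=> [/eqP/(congr1 val)|E]; rewrite ?phiE //.
  by apply/eqP/val_inj; rewrite phiE.
have imphi : piece (jacobian f) (k + d.-1) = limg phi.
  apply/vspaceP => u; apply/idP/idP => [/(mem_piece _ (jacobian_ideal f))|/memv_imgP[s _ ->]].
    move=> /(jacobian_graded hf (hval u))[c [hc E]].
    have [|s Es] := @row_of_exists (\row_j c j); first by move=> j; rewrite mxE.
    apply/memv_imgP; exists s; rewrite ?memvf //; apply: val_inj.
    by rewrite phiE Es E; apply: eq_bigr => j _; rewrite mxE.
  apply/(mem_piece _ (jacobian_ideal f)); rewrite phiE.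
  by exists (fun j => row_of s 0 j).
have := limg_ker_dim phi fullv; rewrite capfv -imphi.
have := codimvK (piece (jacobian f) (k + d.-1)); rewrite -/(hilbert _ _).
have -> : \dim {:V} = (3 * \dim {:dhomog 3 K k})%N by rewrite !dimvf /dim /= card_ord.
move: (\dim _) (\dim _) (\dim _) (\dim _) (hilbert _ _); lia.
Qed.

(** By [syzygy_kernel] the kernel of Delta(r1, .) on Z is the space of the h r1 with h of degree k -
    d1. *)
Lemma Delta_image (Z : {vspace V}) : (d1 <= k)%N ->
  (forall u, u \in Z <-> AR f (row_of u)) ->
  exists W : {vspace dhomog 3 K (d1 + k).+1},
    (forall u, u \in W <-> exists s, [/\ vhomog k s, AR f s & val u = Delta r1 s]) /\
    (\dim W + \dim {:dhomog 3 K (k - d1)} = \dim Z)%N.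
Proof.
move=> le1 ZP; have [||del delE] := @dhomog_hom K V (d1 + k).+1 (fun u => Delta r1 (row_of u)).
- by move=> c u v; rewrite row_of_linear DeltaD DeltaZ mul_mpolyC.
- by move=> u; apply: Delta_homog => //; apply: row_of_homog.
have [mu muE] : exists mu : 'Hom(dhomog 3 K (k - d1), V),
    forall h, row_of (mu h) = val h *: r1.
  have hmu (h : dhomog 3 K (k - d1)) j : val h * r1 0 j \is k.-homog.
    exact: dhomogM_eq (hval h) (h1 j) (subnK le1).
  have [|mu muE] := @linear_hom _ (dhomog 3 K (k - d1)) V (fun h => [ffun j => DHomog (hmu h j)]).
    move=> c u v; apply/ffunP => j; rewrite !ffunE; apply: val_inj.
    by rewrite /= mulrDl -scalerAl.
  by exists mu => h; apply/rowP => j; rewrite muE !mxE ffunE.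
have muI : (lker mu == 0)%VS.
  rewrite -subv0; apply/subvP => h; rewrite memv_ker memv0 => /eqP mh.
  have [j rj] := row_neq0 r1_neq0; apply/eqP/val_inj/(mulIf rj).
  have := congr1 (fun s : 'rV[S]_3 => s 0 j) (muE h).
  by rewrite mh !mxE ffunE /= => <-; rewrite mul0r.
have immu : (Z :&: lker del)%VS = limg mu.
  apply/vspaceP => u; apply/idP/idP => [|/memv_imgP[h _ ->]]; last first.
    rewrite memv_cap; apply/andP; split.
      by apply/ZP; rewrite muE; apply: ARZ.
    by rewrite memv_ker; apply/eqP/val_inj; rewrite delE muE DeltaZ Delta_self mulr0.
  rewrite memv_cap => /andP[/ZP Hu]; rewrite memv_ker => /eqP/(congr1 val).
  rewrite delE => /(syzygy_kernel Hu)[h Eh].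
  have hh := pihomogP mdeg (k - d1) h.
  apply/memv_imgP; exists (DHomog hh); rewrite ?memvf //.
  apply: row_of_inj; rewrite muE; apply/rowP => j.
  have hj := row_of_homog u j; rewrite -(pihomog_dE hj) [in LHS]Eh !mxE /=.
  by rewrite -(pihomogM _ _ (h1 j)) subnK.
exists (del @: Z)%VS; split=> [u|].
  split=> [/memv_imgP[s /ZP Hs ->]|[s [hs Hs E]]].
    by exists (row_of s); rewrite delE; split => //; apply: row_of_homog.
  have [v Ev] := row_of_exists hs; apply/memv_imgP; exists v.
    by apply/ZP; rewrite Ev.
  by apply: val_inj; rewrite delE Ev.
have := limg_ker_dim del Z; rewrite immu (limg_dim_eq (f := mu)); last by rewrite (eqP muI) capv0.
by rewrite addnC.
Qed.

End Syzygies.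

Lemma ci_degrees : [/\ (d <= d1 + d2)%N, (d <= d1 + d3)%N,
  g2 \is ((d1 + d2).+1 - d).-homog & g3 \is ((d1 + d3).+1 - d).-homog].
Proof.
have [g20 g30] := ci_neq0; have [g2U g3U] := ci_nonunit.
have [le2 hg2] := quotient_degree h2 E2 g20 g2U.
by have [le3 hg3] := quotient_degree h3 E3 g30 g3U.
Qed.

Lemma ci_syzygy a b : a * Delta r1 r2 + b * Delta r1 r3 = 0 ->
  exists h, a = h * g3 /\ b = - (h * g2).
Proof.
have cancel_f (x y : S) : a * (x * f) + b * (y * f) = 0 -> a * x = - b * y.
  move=> E; apply: (mulIf f0); apply/eqP; rewrite -subr_eq0; apply/eqP.
  by rewrite -[RHS]E; ring.
have second (x y h : S) : y != 0 -> a * x = - b * y -> a = h * y -> b = - (h * x).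
  move=> y0 E Ea; apply: (mulIf y0).
  have -> : b * y = - (a * x) by rewrite E; ring.
  by rewrite Ea; ring.
have [_ g30] := ci_neq0.
rewrite E2 E3 => /cancel_f E.
have [|h Eh] := @mpoly_coprime_mdvd K 3 g3 g2 _ _ g30 _ E.
  by move=> e e3 e2; have [cop _] := ci; apply: cop.
by exists h; split; [exact: Eh|exact: (second _ _ _ g30 E Eh)].
Qed.

Lemma koszul_image k : (d1 + d2 + d3 <= k)%N ->
  exists P : {vspace dhomog 3 K (d1 + k).+1},
    (forall u, u \in P <-> exists a b, [/\ a \is (k - d2).-homog, b \is (k - d3).-homog &
         val u = a * Delta r1 r2 + b * Delta r1 r3]) /\
    (\dim P + \dim {:dhomog 3 K (k - d2 - ((d1 + d3).+1 - d))} =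
     \dim {:dhomog 3 K (k - d2)} + \dim {:dhomog 3 K (k - d3)})%N.
Proof.
move=> lek; have [le2 le3 hg2 hg3] := ci_degrees; have [_ g30] := ci_neq0.
have [n2 n3 c2 c3] : [/\ (k - d2 + (d1 + d2).+1 = (d1 + k).+1)%N,
   (k - d3 + (d1 + d3).+1 = (d1 + k).+1)%N,
   (k - d2 - ((d1 + d3).+1 - d) + ((d1 + d3).+1 - d) = k - d2)%N &
   (k - d2 - ((d1 + d3).+1 - d) + ((d1 + d2).+1 - d) = k - d3)%N].
  by clear -lek le2 le3 d_gt0; split; lia.
have comm : g3 * Delta r1 r2 = g2 * Delta r1 r3 by rewrite E2 E3 mulrCA.
exact: (pair_image (Delta_homog h1 h2) (Delta_homog h1 h3) hg2 hg3 n2 n3 c2 c3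
  g30 comm ci_syzygy).
Qed.

(** Each Delta(r1, s) is f times a form of degree d1 + k + 1 - d. This crude estimate is what bounds
    the Hilbert function of S / J. *)
Lemma Delta_image_bound k (W : {vspace dhomog 3 K (d1 + k).+1}) : (d <= k)%N ->
  (forall u, u \in W -> exists s, [/\ vhomog k s, AR f s & val u = Delta r1 s]) ->
  (\dim W <= \dim {:dhomog 3 K ((d1 + k).+1 - d)})%N.
Proof.
move=> lek HW; set N := ((d1 + k).+1 - d)%N.
have hN : (N + d = (d1 + k).+1)%N by rewrite /N; clear -lek; lia.
have [||mf mfE] := @dhomog_hom K (dhomog 3 K N) (d1 + k).+1 (fun u => val u * f).
- by move=> c u v; rewrite /= mulrDl -scalerAl.
- by move=> u; apply: dhomogM_eq (hval u) hf hN.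
have Wmf : (W <= limg mf)%VS.
  apply/subvP => u /HW[s [hs Hs E]].
  have hg := pihomogP mdeg N (vquot f r1 s).
  apply/memv_imgP; exists (DHomog hg); rewrite ?memvf //; apply: val_inj.
  rewrite mfE /= -(pihomogM _ _ hf) hN -(vquotE hf sqf AR1 Hs) -E.
  by rewrite pihomog_dE.
by rewrite (leq_trans (dimvS Wmf)) // -(limg_ker_dim mf fullv) leq_addl.
Qed.

(** All spaces of forms have dimension (n + 1)(n + 2) / 2 with n - k constant, and in the
    alternating sums the terms in k cancel. The equality compares W with P, the inequality compares
    W with the multiples of f. *)
Lemma hilbert_count k : (d1 + d2 + d3 + d <= k)%N ->
  exists W P : {vspace dhomog 3 K (d1 + k).+1},
  [/\ forall u, u \in W <-> exists s, [/\ vhomog k s, AR f s & val u = Delta r1 s],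
      forall u, u \in P <-> exists a b, [/\ a \is (k - d2).-homog, b \is (k - d3).-homog &
         val u = a * Delta r1 r2 + b * Delta r1 r3],
      (hilbert (jacobian f) (k + d.-1))%:Z =
        (d%:Z - 1) * (d%:Z - d1%:Z - 1) + d1%:Z ^+ 2
        - (d1%:Z - (d%:Z - 1 - d2%:Z)) * (d1%:Z - (d%:Z - 1 - d3%:Z))
        + (\dim W)%:Z - (\dim P)%:Z &
      (hilbert (jacobian f) (k + d.-1))%:Z <= (d%:Z - 1) * (d%:Z - d1%:Z - 1) + d1%:Z ^+ 2].
Proof.
move=> lek; have [le2 le3 _ _] := ci_degrees.
have [Z [ZP EZ]] := syzygies_hilbert k.
have [|W [WP EW]] := @Delta_image k Z _ ZP; first by clear -lek; lia.
have [|P [PP EP]] := @koszul_image k; first by clear -lek; lia.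
have leW : (\dim W <= \dim {:dhomog 3 K ((d1 + k).+1 - d)})%N.
  by apply: Delta_image_bound => [|u /WP //]; clear -lek; lia.
exists W, P; split => //.
all: clear WP PP ZP; move: EZ EW EP leW.
all: have := @dim_dhomog (k + d.-1) (k%:Z + d%:Z - 1) ltac:(clear -d_gt0; lia).
all: have := @dim_dhomog k k%:Z erefl.
all: have := @dim_dhomog (k - d1) (k%:Z - d1%:Z) ltac:(clear -lek; lia).
all: have := @dim_dhomog (k - d2) (k%:Z - d2%:Z) ltac:(clear -lek; lia).
all: have := @dim_dhomog (k - d3) (k%:Z - d3%:Z) ltac:(clear -lek; lia).
all: have := @dim_dhomog (k - d2 - ((d1 + d3).+1 - d))
  (k%:Z - d2%:Z - (d1%:Z + d3%:Z + 1 - d%:Z)) ltac:(clear -lek le3 d_gt0; lia).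
all: have := @dim_dhomog ((d1 + k).+1 - d) (d1%:Z + k%:Z + 1 - d%:Z) ltac:(clear -lek; lia).
all: move: (\dim Z) (\dim W) (\dim P) (hilbert _ _).
all: move: (\dim {:dhomog 3 K (k + d.-1)}) (\dim {:dhomog 3 K k})
  (\dim {:dhomog 3 K (k - d1)}) (\dim {:dhomog 3 K (k - d2)}) (\dim {:dhomog 3 K (k - d3)})
  (\dim {:dhomog 3 K (k - d2 - ((d1 + d3).+1 - d))}) (\dim {:dhomog 3 K ((d1 + k).+1 - d)}).
all: clear; lia.
Qed.

End Counting.

(** * Tjurina number and minimal generators *)

Section TjurinaFormula.
Variable K : numClosedFieldType.
Local Notation S := {mpoly K[3]}.
Variables (f : S) (d : nat) (r1 r2 r3 : 'rV[S]_3) (d1 d2 d3 : nat).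
Hypotheses (d_gt0 : (0 < d)%N) (hf : f \is d.-homog) (sqf : squarefree f).
Hypotheses (AR1 : AR f r1) (AR2 : AR f r2) (AR3 : AR f r3).
Hypotheses (h1 : vhomog d1 r1) (h2 : vhomog d2 r2) (h3 : vhomog d3 r3).
Hypothesis r1_neq0 : r1 != 0.
Hypothesis r1_min : forall s, AR f s -> s != 0 -> exists i, (d1 < msize (s 0%R i))%N.
Variables g2 g3 : S.
Hypotheses (E2 : Delta r1 r2 = g2 * f) (E3 : Delta r1 r3 = g3 * f).
Hypothesis ci : complete_intersection2 g2 g3.

Let count := hilbert_count d_gt0 hf sqf AR1 h1 h2 h3 r1_neq0 r1_min E2 E3 ci.

Let bound : int := (d%:Z - 1) * (d%:Z - d1%:Z - 1) + d1%:Z ^+ 2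
  - (d1%:Z - (d%:Z - 1 - d2%:Z)) * (d1%:Z - (d%:Z - 1 - d3%:Z)).

Lemma tjurina_count : exists k0, forall k, (k0 <= k)%N ->
  exists W P : {vspace dhomog 3 K (d1 + k).+1},
  [/\ forall u, u \in W <-> exists s, [/\ vhomog k s, AR f s & val u = Delta r1 s],
      forall u, u \in P <-> exists a b, [/\ a \is (k - d2).-homog, b \is (k - d3).-homog &
         val u = a * Delta r1 r2 + b * Delta r1 r3],
      (P <= W)%VS &
      (total_tjurina f)%:Z = bound + (\dim W)%:Z - (\dim P)%:Z].
Proof.
(* The bound from [hilbert_count] is an integer; its absolute value serves as the natural number
   required. *)
pose c := absz ((d%:Z - 1) * (d%:Z - d1%:Z - 1) + d1%:Z ^+ 2).
have [k1|k1 Hk1] := @total_tjurina_hilbert K d f c (d1 + d2 + d3 + d + d.-1) d_gt0 hf.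
  move=> le; have le' : (d1 + d2 + d3 + d <= k1 - d.-1)%N by clear -le; lia.
  have [W [P [_ _ _]]] := count le'.
  rewrite subnK; last by clear -le; lia.
  by rewrite /c; move: (hilbert _ _) (_ + _ ^+ 2) => x y; clear; lia.
exists (k1 + (d1 + d2 + d3 + d))%N => k le.
have le' : (d1 + d2 + d3 + d <= k)%N by clear -le; lia.
have [W [P [WP PP EH _]]] := count le'; exists W, P; split => //.
  apply/subvP => u /PP[a [b [ha hb E]]]; apply/WP; exists (a *: r2 + b *: r3).
  split; last by rewrite E DeltaD !DeltaZ.
    move=> j; rewrite !mxE; apply: rpredD.
      by apply: dhomogM_eq ha (h2 j) _; clear -le; lia.
    by apply: dhomogM_eq hb (h3 j) _; clear -le; lia.
  by apply: ARD; apply: ARZ.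
by rewrite -EH Hk1 //; clear -le; lia.
Qed.

Lemma tjurina_lower_bound : bound <= (total_tjurina f)%:Z.
Proof.
have [k0 H] := tjurina_count; have [W [P [_ _ /dimvS le ->]]] := H k0 (leqnn _).
by move: le bound; clear; lia.
Qed.

(** Lowers n by one at a time: if forms of degree n + 1 send v into (g2, g3), then for h of degree n
    every X_i sends h v there, and the socle of S / (g2, g3) is zero. *)
Lemma ci_saturated n v : (forall h, h \is n.-homog -> exists p q, h * v = p * g2 + q * g3) ->
  exists p q, v = p * g2 + q * g3.
Proof.
have [cop _] := ci; have [g20 g30] := ci_neq0 ci.
elim: n => [|n IH] H; first by have [p [q]] := H 1 (dhomog1 _ _); rewrite mul1r; exists p, q.
apply: IH => h hh; apply: (complete_intersection_socle g20 g30 cop) => i.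
have [|p [q E]] := H ('X_i * h); last by exists p, q; rewrite mulrA.
exact: dhomogM_eq (dhomog_U K i) hh (add1n n).
Qed.

Lemma tjurina_bound_attained : (total_tjurina f)%:Z = bound <->
  forall k s, vhomog k s -> AR f s ->
    exists a b c, s = a *: r1 + b *: r2 + c *: r3.
Proof.
have [k0 H] := tjurina_count; split=> [E k s hs Hs|gen].
  have [g Eg] := Delta_dvd hf sqf AR1 Hs.
  have [|p [q Epq]] := @ci_saturated k0 g.
    (* Each form h of degree k0 moves s to the degree k0 + k, where equality of dimensions gives P =
       W; so h g lies in (g2, g3). *)
    move=> h hh; have [W [P [WP PP leP]]] := H (k0 + k)%N (leq_addr _ _).
    rewrite E => Edim; have {leP Edim} EWP : P = W.
      apply/eqP; rewrite eqEdim leP /=; move: Edim; move: bound; clear; lia.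
    have hhs : vhomog (k0 + k) (h *: s) by move=> j; rewrite mxE; apply: dhomogM.
    have hD := Delta_homog h1 hhs.
    have : DHomog hD \in P by rewrite EWP; apply/WP; exists (h *: s); split => //; apply: ARZ.
    move=> /PP[a [b [_ _]]] /=; rewrite DeltaZ Eg E2 E3 => Eab; exists a, b.
    have [f0 _] := sqf; apply: (mulIf f0).
    by rewrite mulrDl -!mulrA Eab.
  have [||h Eh] := syzygy_kernel d_gt0 hf sqf AR1 h1 r1_neq0 r1_min (s := s - p *: r2 - q *: r3).
  - by rewrite -!scaleNr; apply: ARD (ARD Hs (ARZ _ AR2)) (ARZ _ AR3).
  - rewrite -!scaleNr !DeltaD !DeltaZ Eg E2 E3 Epq; ring.
  exists h, p, q; by rewrite -Eh [RHS]addrAC !subrK.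
(* For the converse a single degree suffices; it is at least d2 + d3, so that k - d2 and k - d3 are
   not truncated. *)
have [W [P [WP PP leP ->]]] := H (k0 + d2 + d3)%N (leq_trans (leq_addr _ _) (leq_addr _ _)).
suff -> : W = P by rewrite addrK.
apply/eqP; rewrite eqEsubv leP andbT; apply/subvP => u /WP[s [hs Hs E]].
have [a [b [c Es]]] := gen _ _ hs Hs; apply/PP; set k := (k0 + d2 + d3)%N.
exists (pihomog mdeg (k - d2) b), (pihomog mdeg (k - d3) c).
split; try exact: pihomogP.
have hD2 := Delta_homog h1 h2; have hD3 := Delta_homog h1 h3.
rewrite -(pihomogM _ _ hD2) -(pihomogM _ _ hD3).
have -> : (k - d2 + (d1 + d2).+1 = (d1 + k).+1)%N by rewrite /k; clear; lia.
have -> : (k - d3 + (d1 + d3).+1 = (d1 + k).+1)%N by rewrite /k; clear; lia.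
rewrite -raddfD /= -(pihomog_dE (dhomog_is_dhomog u)); congr (pihomog _ _ _).
by rewrite E Es !DeltaD !DeltaZ Delta_self mulr0 add0r.
Qed.

End TjurinaFormula.

Lemma pihomog_degree0 n (R : nzRingType) (h : {mpoly R[n]}) :
  pihomog mdeg 0 h = (h@_0%MM)%:MP.
Proof.
have hP k := pihomogP mdeg k h.
rewrite [LHS]msize1_polyC; last first.
  by rewrite msizeE; apply/bigmax_leqP_seq => m /(dhomog_mf (hP 0%N)) /= ->.
congr _%:MP.
have -> : h@_0%MM = \sum_(k < (msize h).+1) (pihomog mdeg k h)@_0%MM.
  by rewrite -(raddf_sum (mcoeff 0%MM)) -pihomog_partitionE.
rewrite big_ord_recl big1 ?addr0 // => k _.
by apply: (dhomog_nemf_coeff (hP _)); rewrite /= mdeg0.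
Qed.

(** * Minimal systems of generators *)

Section MinimalGenerators.
Variable K : fieldType.
Local Notation S := {mpoly K[3]}.
Variable f : S.

Lemma generates_without m (r : m.-tuple 'rV[S]_3) l (c : 'I_m -> S) :
  generatesAR f r finset.setT ->
  tnth r l = \sum_(j | j != l) c j *: tnth r j ->
  generatesAR f r [set~ l].
Proof.
move=> gen El s /gen[a ->]; exists (fun j => a j + a l * c j).
rewrite [RHS](eq_bigl (fun j => j != l)); last by move=> j; rewrite !inE.
rewrite [LHS](eq_bigl xpredT) => [|j]; last by rewrite inE.
rewrite (bigD1 l) //= El scaler_sumr -big_split; apply: eq_bigr => j _ /=.
by rewrite scalerDl scalerA addrC.
Qed.

Lemma minimal_no_without m (r : m.-tuple 'rV[S]_3) ds l :
  min_generators f r ds -> ~ generatesAR f r [set~ l].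
Proof.
move=> [_ _ _ min]; apply: min; rewrite finset.properEneq finset.subsetT andbT.
apply/eqP => E; have := finset.in_setT l.
by rewrite -E !inE eqxx.
Qed.

Lemma min_generators_neq0 m (r : m.-tuple 'rV[S]_3) ds j :
  min_generators f r ds -> tnth r j != 0.
Proof.
move=> Hr; apply/eqP => r0; apply: (minimal_no_without (l := j) Hr).
have [_ _ gen _] := Hr; apply: (@generates_without _ _ _ (fun=> 0)) => //.
by rewrite r0 big1 // => i _; rewrite scale0r.
Qed.

(** A graded Nakayama argument: if h_l had a nonzero constant term, the component of the relation in
    the degree of r_l would have this constant as coefficient of r_l, and r_l could be dropped. *)
Lemma min_generators_relation m (r : m.-tuple 'rV[S]_3) ds (h : 'I_m -> S) :
  min_generators f r ds -> \sum_j h j *: tnth r j = 0 -> forall l, (h l)@_0%MM = 0.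
Proof.
move=> Hr E l; apply/eqP/negPn/negP => hl0.
have [_ hom gen _] := Hr.
pose a j := if (tnth ds j <= tnth ds l)%N
  then pihomog mdeg (tnth ds l - tnth ds j) (h j) else 0.
have Ea : \sum_j a j *: tnth r j = 0.
  apply/rowP => i; rewrite summxE mxE.
  have Ei : \sum_j (h j *: tnth r j) 0 i = 0 by rewrite -summxE E mxE.
  transitivity (pihomog mdeg (tnth ds l) (\sum_j (h j *: tnth r j) 0 i)); last first.
    by rewrite Ei pihomog0.
  rewrite (raddf_sum (pihomog mdeg (tnth ds l))); apply: eq_bigr => j _.
  rewrite !mxE /a; case: leqP => [le|lt].
    by have := pihomogM (h j) (tnth ds l - tnth ds j) (hom j i); rewrite subnK.
  by rewrite mul0r; symmetry; apply: (pihomogM_lt _ (hom j i) lt).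
have al : a l = ((h l)@_0%MM)%:MP by rewrite /a leqnn subnn pihomog_degree0.
apply: (minimal_no_without (l := l) Hr).
apply: (@generates_without _ _ _ (fun j => - ((h l)@_0%MM)^-1 *: a j)) => //.
have Ml : a l *: tnth r l = - \sum_(j | j != l) a j *: tnth r j.
  by apply/eqP; rewrite -addr_eq0; apply/eqP; move: Ea; rewrite (bigD1 l).
under eq_bigr do rewrite -mul_mpolyC -scalerA.
rewrite -scaler_sumr -[\sum_(j | _) _]opprK -Ml al scalerN -scaleNr.
by rewrite scalerA -mpolyCN opprK -mpolyCM mulVf // mpolyC1 scale1r.
Qed.

(* Expressing two minimal systems through one another gives matrices whose
   constant terms are inverse to each other. *)
Lemma min_generators_size m m' (r : m.-tuple 'rV[S]_3) ds (r' : m'.-tuple 'rV[S]_3) ds' :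
  min_generators f r ds -> min_generators f r' ds' -> (m <= m')%N.
Proof.
move=> Hr Hr'; have [ARr _ gen _] := Hr; have [ARr' _ gen' _] := Hr'.
have /choice[C HC] := fun j => gen' _ (ARr j).
have /choice[E HE] := fun j => gen _ (ARr' j).
pose C0 := \matrix_(j, i) (C j i)@_0%MM; pose E0 := \matrix_(i, l) (E i l)@_0%MM.
suff /mulmx1_min : C0 *m E0 = 1%:M by [].
apply/matrixP => j l.
have rel : \sum_l ((j == l)%:R - \sum_i C j i * E i l) *: tnth r l = 0.
  under eq_bigr do rewrite scalerBl scaler_suml.
  rewrite sumrB exchange_big /= (bigD1 j) //= eqxx scale1r big1 ?addr0; last first.
    by move=> i /negPf; rewrite eq_sym => ->; rewrite scale0r.
  apply/eqP; rewrite subr_eq0 {1}HC; apply/eqP.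
  rewrite [LHS](eq_bigl xpredT) => [|i]; last by rewrite inE.
  apply: eq_bigr => i _; rewrite HE scaler_sumr.
  rewrite [LHS](eq_bigl xpredT) => [|i']; last by rewrite inE.
  by apply: eq_bigr => i' _; rewrite scalerA.
have := min_generators_relation Hr rel l.
rewrite raddfB /= raddf_sum /= => /eqP; rewrite subr_eq0 => /eqP Ejl.
have E01 : ((j == l)%:R : S)@_0%MM = (j == l)%:R.
  by rewrite -mpolyC_nat mcoeffC eqxx mulr1.
rewrite !mxE; apply: etrans (etrans (esym Ejl) E01).
by apply: eq_bigr => i _; rewrite !mxE rmorphM.
Qed.

(** A combination of generators of degree at least d1 has no components in lower degrees. *)
Lemma min_generators_degree m (r : m.-tuple 'rV[S]_3) ds d1 s :
  min_generators f r ds -> (forall j, d1 <= tnth ds j)%N -> AR f s -> s != 0 ->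
  exists i, (d1 < msize (s 0%R i))%N.
Proof.
move=> [_ hom gen _] le /gen[c Es] s0; apply: contrapT => /forallNP H.
case/eqP: s0; apply/rowP => i; rewrite mxE.
have /negP := H i; rewrite -leqNgt => /pihomog_partitionE ->.
rewrite big1 // => k _; rewrite Es summxE (raddf_sum (pihomog mdeg k)) big1 // => j _.
by rewrite mxE /=; apply: (pihomogM_lt _ (hom j i)); apply: leq_trans (le j).
Qed.

End MinimalGenerators.

(** The generators are themselves homogeneous syzygies, so the three span all of AR(f), and by
    minimality there are no others. *)
Lemma first_three_generate (K : fieldType) (f : {mpoly K[3]}) m
    (r : m.-tuple 'rV[{mpoly K[3]}]_3) ds (j0 j1 j2 : 'I_m) :
  min_generators f r ds -> uniq [:: j0; j1; j2] ->
  (forall k s, vhomog k s -> AR f s -> exists a b c,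
     s = a *: tnth r j0 + b *: tnth r j1 + c *: tnth r j2) ->
  (m <= 3)%N.
Proof.
move=> [ARr hom gen min] /= /andP[]; rewrite !inE negb_or => /andP[n01 n02] /andP[n12 _] H.
pose J := finset.setU (finset.setU [set j0] [set j1]) [set j2].
rewrite leqNgt; apply/negP => lt; apply: (min J).
  rewrite finset.properEcard finset.subsetT finset.cardsT card_ord.
  apply: leq_ltn_trans lt; rewrite /J.
  by apply: leq_trans (finset.leq_card_setU _ _) _; rewrite finset.cards1 finset.cards2; case: (_ != _).
have /choice[A HA] : forall j, exists a : 'I_m -> {mpoly K[3]},
    tnth r j = \sum_(i in J) a i *: tnth r i.
  move=> j; have [a [b [c E]]] := H _ _ (hom j) (ARr j).
  exists (fun i => if i == j0 then a else if i == j1 then b else c).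
  rewrite {1}E (bigD1 j0) /=; last by rewrite !inE eqxx.
  rewrite (bigD1 j1) /=; last by rewrite !inE eqxx orbT /= eq_sym n01.
  rewrite (bigD1 j2) /=; last by rewrite !inE eqxx orbT /= !(eq_sym j2) n02 n12.
  rewrite big1 ?addr0; last first.
    by move=> i; rewrite !inE => /andP[/andP[/andP[/orP[/orP[]|] /eqP-> ]]]; rewrite ?eqxx.
  by rewrite !eqxx !(eq_sym j1) !(eq_sym j2) (negPf n01) (negPf n02) (negPf n12) addrA.
move=> s /gen[c ->]; exists (fun i => \sum_(j in finset.setT) c j * A j i).
under [RHS]eq_bigr do rewrite scaler_suml.
rewrite exchange_big /=; apply: eq_bigr => j _; rewrite {1}(HA j) scaler_sumr.
by apply: eq_bigr => i _; rewrite scalerA.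
Qed.

Lemma sum_three (V : nmodType) m (F : 'I_m -> V) (j0 j1 j2 : 'I_m) : (m <= 3)%N ->
  uniq [:: j0; j1; j2] -> \sum_j F j = F j0 + F j1 + F j2.
Proof.
move=> m3 uj; have [_ E] : (size [:: j0; j1; j2] = size (enum 'I_m)) * ([:: j0; j1; j2] =i enum 'I_m).
  by apply: uniq_min_size => // [x _|]; rewrite ?mem_enum // size_enum_ord.
rewrite -big_enum (perm_big [:: j0; j1; j2]) /=; last first.
  by apply: uniq_perm => [||x]; rewrite ?enum_uniq // E.
by rewrite !big_cons big_nil addr0 addrA.
Qed.

Theorem corollary3p4 (R : realType) (d : nat) (f : {mpoly R[i][3]})
  (m : nat) (r : m.-tuple 'rV[{mpoly R[i][3]}]_3) (ds : m.-tuple nat) :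
  (3 <= d)%N ->
  f \is d.-homog ->
  squarefree f ->
  min_generators f r ds ->
  sorted leq ds ->
  (3 <= m)%N ->
  complete_intersection2 (vquot f r`_0 r`_1) (vquot f r`_0 r`_2) ->
  let tau := (total_tjurina f)%:Z in
  let D := d%:Z in
  let d1 := (nth 0%N ds 0)%:Z in
  let d2 := (nth 0%N ds 1)%:Z in
  let d3 := (nth 0%N ds 2)%:Z in
  let bound := (D - 1) * (D - d1 - 1) + d1 ^+ 2
               - (d1 - (D - 1 - d2)) * (d1 - (D - 1 - d3)) in
  tau >= bound /\ (tau = bound <-> syzygy_curve f 3).
Proof.
move=> d_ge3 hf sqf Hr srt m_ge3 ci tau D d1 d2 d3 bound.
have d_gt0 : (0 < d)%N by apply: leq_trans d_ge3.
pose j0 := Ordinal (leq_trans (isT : 0 < 3)%N m_ge3).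
pose j1 := Ordinal (leq_trans (isT : 1 < 3)%N m_ge3).
pose j2 := Ordinal (leq_trans (isT : 2 < 3)%N m_ge3).
have [ARr hom gen _] := Hr.
have A1 := ARr j0; have A2 := ARr j1; have A3 := ARr j2.
have H1 := hom j0; have H2 := hom j1; have H3 := hom j2.
have r1_neq0 := min_generators_neq0 j0 Hr.
have d1_min j : (tnth ds j0 <= tnth ds j)%N.
  rewrite !(tnth_nth 0%N); apply: (sorted_leq_nth leq_trans leqnn 0%N srt) => //.
    by rewrite inE size_tuple (leq_trans _ m_ge3).
  by rewrite inE size_tuple.
have r1_min s (Hs : AR f s) (s0 : s != 0) := min_generators_degree Hr d1_min Hs s0.
have E2 := vquotE hf sqf A1 A2; have E3 := vquotE hf sqf A1 A3.
have ci' : complete_intersection2 (vquot f (tnth r j0) (tnth r j1))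
    (vquot f (tnth r j0) (tnth r j2)) by rewrite !(tnth_nth 0).
have lb := tjurina_lower_bound d_gt0 hf sqf A1 A2 A3 H1 H2 H3 r1_neq0 r1_min E2 E3 ci'.
have att := tjurina_bound_attained d_gt0 hf sqf A1 A2 A3 H1 H2 H3 r1_neq0 r1_min E2 E3 ci'.
have Ebound : bound = (d%:Z - 1) * (d%:Z - (tnth ds j0)%:Z - 1) + (tnth ds j0)%:Z ^+ 2
  - ((tnth ds j0)%:Z - (d%:Z - 1 - (tnth ds j1)%:Z))
    * ((tnth ds j0)%:Z - (d%:Z - 1 - (tnth ds j2)%:Z)).
  by rewrite !(tnth_nth 0%N).
split; first by rewrite Ebound.
rewrite Ebound /tau att; split=> [span|[r' [ds' Hr']] k s hs Hs].
  have m_le3 : (m <= 3)%N by apply: (first_three_generate (j0 := j0) (j1 := j1) (j2 := j2) Hr).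
  have m3 : m = 3 by apply/eqP; rewrite eqn_leq m_le3.
  by move: r ds Hr {srt ci tau D d1 d2 d3 bound ARr hom gen A1 A2 A3 H1 H2 H3 r1_neq0 d1_min r1_min E2 E3 ci' lb att Ebound span}; rewrite m3 => r ds Hr; exists r, ds.
(* A minimal system with three elements forces m to be at most 3, so the given generators are just
   the first three. *)
have [c ->] := gen s Hs.
exists (c j0), (c j1), (c j2).
rewrite (eq_bigl xpredT) => [|j]; last by rewrite finset.in_setT.
by apply: sum_three; first exact: min_generators_size Hr Hr'.
Qed.
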